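(* Let $(M,\tau)$ be a tracial von Neumann algebra with a finitely generated unital $*$-subalgebra $A\subset M$. If $A$ has a diffuse central element (that is, a diffuse element lying in the center of $A$), then $\sigma(A,\tau)=1$.
   Context: A tracial von Neumann algebra $(M,\tau)$ is a finite von Neumann algebra $M$ with a faithful normal tracial state $\tau$. A normal element $x\in M$ is diffuse if its spectral distribution with respect to $\tau$ has no atoms (equivalently $\ker(x-\lambda)=\{0\}$ for all $\lambda\in\mathbb{C}$). $M^\circ$ is the opposite algebra with trace $\tau^\circ$, and $M\bar\otimes M^\circ$ carries the trace $\tau\otimes\tau^\circ$. For a unital $*$-subalgebra $A\subset M$, $L^2(A\otimes A^\circ,\tau\otimes\tau^\circ)$ is the closure of $A\otimes A^\circ$ in $L^2(M\bar\otimes M^\circ,\tau\otimes\tau^\circ)$ and $(A\otimes A^\circ)''$ is the von Neumann algebra generated by $A\otimes A^\circ$. This Hilbert space is an $A$-$A$ bimodule via $x\cdot\xi\cdot y=(x\otimes y^\circ)\xi$, and has the commuting right action of $(A\otimes A^\circ)''$ by right multiplication. A derivation is a linear map $\delta\colon A\to L^2(A\otimes A^\circ,\tau\otimes\tau^\circ)$ with $\delta(xy)=x\cdot\delta(y)+\delta(x)\cdot y$. Finitely generated means generated as a unital $*$-algebra by a finite set. $\mathrm{Der}_{1\otimes1}(A,\tau)$ is the space of derivations $\delta$ such that $1\otimes1\in\mathrm{dom}(\delta^* )$, where $\delta$ is viewed as a densely defined operator $L^2(A,\tau)\to L^2(A\otimes A^\circ,\tau\otimes\tau^\circ)$. If $X=X^*$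 is a finite generating set of $A$, then $\phi_X(\delta)=(\delta(x))_{x\in X}$ is an injective right $(A\otimes A^\circ)''$-linear map with closed range from the space of all derivations on $A$ into $L^2(A\otimes A^\circ,\tau\otimes\tau^\circ)^X$, giving the norm $\|\delta\|_X=(\sum_{x\in X}\|\delta(x)\|^2)^{1/2}$; the topology is independent of $X$, and closures are taken in it. The free Stein dimension is \[\sigma(A,\tau)=\dim\overline{\mathrm{Der}_{1\otimes1}(A,\tau)}_{(A\otimes A^\circ)''},\] the von Neumann dimension (with respect to $\tau\otimes\tau^\circ$) of the right Hilbert $(A\otimes A^\circ)''$-module $\phi_X\big(\overline{\mathrm{Der}_{1\otimes1}(A,\tau)}\big)\subset L^2(A\otimes A^\circ,\tau\otimes\tau^\circ)^X$; it does not depend on $X$. *)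

(* Defs.v *)
From HB Require Import structures.
From mathcomp Require Import all_boot all_order all_algebra.
From mathcomp Require Import all_classical all_reals all_analysis.
From mathcomp.real_closed Require Import complex.

Set Implicit Arguments.
Unset Strict Implicit.
Unset Printing Implicit Defensive.
Import Order.TTheory GRing.Theory Num.Theory.
Local Open Scope classical_set_scope.
Local Open Scope complex_scope.
Local Open Scope ring_scope.

(* Inner products are linear in the first variable. *)
Definition form_norm (R : realType) (V : lmodType R[i])
    (d : {dot V for Num.conj}) (u : V) : R :=
  Num.sqrt (complex.Re (d u u)).

Record hilbert (R : realType) := Hilbert {
  hilbert_sort :> lmodType R[i];
  hdot : {dot hilbert_sort for Num.conj};
  hilbert_complete : forall u : nat -> hilbert_sort,
    (forall e : R, 0 < e -> exists N : nat, forall m n : nat,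
       (N <= m)%N -> (N <= n)%N -> form_norm hdot (u m - u n) < e) ->
    exists l, forall e : R, 0 < e -> exists N : nat, forall n : nat,
       (N <= n)%N -> form_norm hdot (u n - l) < e }.

Notation "''[' u , v ]" := (hdot _ u v) : ring_scope.

Definition hnorm (R : realType) (H : hilbert R) (u : H) : R :=
  form_norm (hdot H) u.

Notation op H := (hilbert_sort H -> hilbert_sort H).

Section Operators.
Variables (R : realType) (H : hilbert R).
Implicit Types (f g : op H) (S A M : set (op H)).

Definition bounded_op f :=
  linear f /\ exists c : R, forall u, hnorm (f u) <= c * hnorm u.

Definition is_adjoint f g := forall u v : H, '[f u, v] = '[u, g v].

(* The adjoint; it is unique, and it exists as soon as f is bounded. *)
Definition adj f : op H := xget (fun=> 0) [set g | is_adjoint f g].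

Definition positive_op f := forall u : H, 0 <= '[f u, u].

Definition le_op f g := positive_op (g \- f).

Definition star_subalgebra A :=
  [/\ A `<=` bounded_op, A idfun,
      (forall (a : R[i]) f g, A f -> A g -> A (a \*: f \+ g)),
      (forall f g, A f -> A g -> A (f \o g)) &
      (forall f, A f -> exists2 g, A g & is_adjoint f g)].

Definition commutant S : set (op H) :=
  [set f | bounded_op f /\ forall g, S g -> f \o g = g \o f].

Definition von_neumann_algebra M :=
  star_subalgebra M /\ commutant (commutant M) = M.

Definition finite_vna M :=
  forall x, M x -> adj x \o x = idfun -> x \o adj x = idfun.

Definition tracial_state M (tau : op H -> R[i]) :=
  [/\ (forall (a : R[i]) x y, M x -> M y ->
         tau (a \*: x \+ y) = a * tau x + tau y),
      tau idfun = 1,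
      (forall x, M x -> 0 <= tau (adj x \o x)) &
      (forall x y, M x -> M y -> tau (x \o y) = tau (y \o x))].

Definition faithful M (tau : op H -> R[i]) :=
  forall x, M x -> tau (adj x \o x) = 0 -> x = (fun=> 0).

(* tau preserves the suprema, in M, of upward directed subsets of the positive
   cone.  On R[i], z <= w means that w - z is a nonnegative real. *)
Definition normal_state M (tau : op H -> R[i]) :=
  forall (D : set (op H)) x,
    D `<=` M -> D !=set0 -> (forall d, D d -> positive_op d) ->
    (forall d d', D d -> D d' -> exists e, [/\ D e, le_op d e & le_op d' e]) ->
    M x -> (forall d, D d -> le_op d x) ->
    (forall y, M y -> (forall d, D d -> le_op d y) -> le_op x y) ->
    (forall d, D d -> tau d <= tau x) /\
    (forall c, (forall d, D d -> tau d <= c) -> tau x <= c).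

Definition is_tracial_vna M (tau : op H -> R[i]) :=
  [/\ von_neumann_algebra M, finite_vna M, tracial_state M tau,
      faithful M tau & normal_state M tau].

End Operators.

Record tracial_vna (R : realType) := TracialVNA {
  vna_space :> hilbert R;
  vna_set : set (op vna_space);
  (* only the values of the trace on vna_set are meaningful *)
  vna_trace : op vna_space -> R[i];
  tracial_vnaP : is_tracial_vna vna_set vna_trace }.

Arguments vna_set {R} _ _.
Arguments vna_trace {R} _ _.

Definition conj_sort (R : realType) (H : hilbert R) : Type := H.

Section ConjugateSpace.
Variables (R : realType) (H : hilbert R).

HB.instance Definition _ := GRing.Zmodule.copy (conj_sort H) H.

Let cscale (a : R[i]) (u : conj_sort H) : conj_sort H := Num.conj a *: (u : H).

Let cscaleA a b u : cscale a (cscale b u) = cscale (a * b) u.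
Proof. by rewrite /cscale scalerA rmorphM. Qed.
Let cscale1 : left_id 1 cscale.
Proof. by move=> u; rewrite /cscale rmorph1 scale1r. Qed.
Let cscaleDr : right_distributive cscale +%R.
Proof. by move=> a u v; rewrite /cscale scalerDr. Qed.
Let cscaleDl u : {morph cscale^~ u : a b / a + b}.
Proof. by move=> a b; rewrite /cscale rmorphD scalerDl. Qed.

HB.instance Definition _ := GRing.Zmodule_isLmodule.Build R[i] (conj_sort H)
  cscaleA cscale1 cscaleDr cscaleDl.

Definition conj_dot (u v : conj_sort H) : R[i] := '[(v : H), (u : H)].

Lemma conj_dot_bilinear : bilinear_for *%R (Num.conj \; *%R) conj_dot.
Proof.
split=> [v a u w|v a u w]; rewrite /conj_dot /=.
  by rewrite linearPr /= conjCK.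
by rewrite linearPl.
Qed.

HB.instance Definition _ := bilinear_isBilinear.Build R[i] (conj_sort H)
  (conj_sort H) R[i] *%R (Num.conj \; *%R) conj_dot conj_dot_bilinear.

Lemma conj_dot_hermitian (u v : conj_sort H) :
  conj_dot u v = (-1) ^+ false * Num.conj (conj_dot v u).
Proof. by rewrite /conj_dot hermC. Qed.

HB.instance Definition _ := isHermitianSesquilinear.Build R[i] (conj_sort H)
  false Num.conj conj_dot conj_dot_hermitian.

Lemma conj_dot_gt0 (u : conj_sort H) : u != 0 -> 0 < conj_dot u u.
Proof. exact: (@neq0_dnorm_gt0 _ _ _ (hdot H) (u : H)). Qed.

HB.instance Definition _ := isDotProduct.Build R[i] (conj_sort H) conj_dot
  conj_dot_gt0.

Definition conj_hilbert : hilbert R :=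
  @Hilbert R (conj_sort H) conj_dot (@hilbert_complete R H).

End ConjugateSpace.

Section Opposite.
Variables (R : realType) (H : hilbert R).
Local Notation Hc := (conj_hilbert H).
Implicit Types (f g : op H) (M : set (op H)).

Lemma is_adjoint_sym f g : is_adjoint f g -> is_adjoint g f.
Proof.
move=> fg u v; have hC (w w' : H) : '[w, w'] = Num.conj '[w', w].
  by rewrite [LHS]hermC expr0 mul1r.
by rewrite hC -fg -hC.
Qed.

Lemma conj_linear f : linear (f : op Hc) <-> linear f.
Proof.
split=> fl a u v; first by rewrite -[a]conjCK; exact: fl.
exact: (fl (Num.conj a)).
Qed.

Lemma conj_bounded_op : @bounded_op R Hc = @bounded_op R H.
Proof.
by apply/funext => f; apply/propext; split=> -[/conj_linear ? ?].
Qed.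

Lemma conj_is_adjoint : @is_adjoint R Hc = @is_adjoint R H.
Proof.
apply/funext => f; apply/funext => g; apply/propext; split=> [fg|fg u v].
  by apply: is_adjoint_sym => u v; exact: esym (fg v u).
exact: esym (is_adjoint_sym fg v u).
Qed.

Lemma conj_adj : @adj R Hc = @adj R H.
Proof. by rewrite /adj conj_is_adjoint. Qed.

Lemma conj_commutant : @commutant R Hc = @commutant R H.
Proof. by rewrite /commutant conj_bounded_op. Qed.

Lemma conj_positive_op : @positive_op R Hc = @positive_op R H.
Proof.
have hC (w w' : H) : '[w, w'] = Num.conj '[w', w].
  by rewrite [LHS]hermC expr0 mul1r.
apply/funext => f; apply/propext; split=> p u; have := p u.
  by move=> h; rewrite hC conjC_ge0.
by rewrite hC conjC_ge0.
Qed.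

Lemma conj_le_op : @le_op R Hc = @le_op R H.
Proof. by rewrite /le_op conj_positive_op. Qed.

Lemma conj_star_subalgebra M :
  star_subalgebra M -> @star_subalgebra R Hc M.
Proof.
case=> b i l c s; split=> //; first by rewrite conj_bounded_op.
- by move=> a f g; exact: (l (Num.conj a)).
- by rewrite conj_is_adjoint.
Qed.

Lemma conj_is_tracial_vna M (tau : op H -> R[i]) :
  is_tracial_vna M tau ->
  @is_tracial_vna R Hc M (fun f => Num.conj (tau f)).
Proof.
case=> -[Ms Mcc] fin [tl t1 t0 tt] tf tn; split.
- by split; [exact: conj_star_subalgebra|rewrite conj_commutant].
- by rewrite /finite_vna conj_adj.
- split.
  + move=> a x y Mx My; rewrite -[a in RHS]conjCK -rmorphM -rmorphD.
    by congr (Num.conj _); exact: tl.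
  + by rewrite t1 rmorph1.
  + by move=> x Mx; rewrite conj_adj conjC_ge0; exact: t0.
  + by move=> x y Mx My; rewrite tt.
- move=> x Mx; rewrite conj_adj => /eqP; rewrite conjC_eq0 => /eqP.
  exact: tf.
- have lC (z w : R[i]) : (Num.conj z <= Num.conj w) = (z <= w).
    by rewrite -subr_ge0 -rmorphB conjC_ge0 subr_ge0.
  move=> D x DM D0; rewrite conj_positive_op conj_le_op => Dp Dd Mx Dx xl.
  have [h1 h2] := tn D x DM D0 Dp Dd Mx Dx xl; split=> [d Dd'|c hc].
    by rewrite lC; exact: h1.
  rewrite -[c]conjCK lC; apply: h2 => d Dd'.
  by rewrite -lC conjCK; exact: hc.
Qed.

End Opposite.

(* The opposite algebra acts on the conjugate Hilbert space: the opposite of x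
   is the operator adj x.  Hence the opposite of M is M itself, viewed as a set
   of operators on the conjugate space, and since tau (adj x) is the conjugate
   of tau x, the opposite trace, which sends adj x to tau x, is conj \o tau. *)
Definition opposite_vna (R : realType) (M : tracial_vna R) : tracial_vna R :=
  @TracialVNA R (conj_hilbert M) (vna_set M)
    (fun f => Num.conj (vna_trace M f)) (conj_is_tracial_vna (tracial_vnaP M)).

(* The Hilbert space of W is the completed tensor product of those of M and N,
   which the fields pureP and pure_total determine up to unitary equivalence;
   W is generated by the operators x (x) y, and its trace, being normal, is
   determined by tensor_trace. *)
Record tensor_vna (R : realType) (M N : tracial_vna R) := TensorVNA {
  tensor_sort :> tracial_vna R;
  pure : {bilinear M -> N -> tensor_sort};
  pureP : forall u u' v v',
    '[pure u v, pure u' v'] = '[u, u'] * '[v, v'];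
  pure_total : forall w, (forall u v, '[pure u v, w] = 0) -> w = 0;
  pure_op : op M -> op N -> op tensor_sort;
  pure_opP : forall x y, vna_set M x -> vna_set N y ->
    bounded_op (pure_op x y) /\
    forall u v, pure_op x y (pure u v) = pure (x u) (y v);
  tensor_gen : vna_set tensor_sort = commutant (commutant
    [set f | exists2 x, vna_set M x & exists2 y, vna_set N y &
             f = pure_op x y]);
  tensor_trace : forall x y, vna_set M x -> vna_set N y ->
    vna_trace tensor_sort (pure_op x y) = vna_trace M x * vna_trace N y }.

Arguments pure_op {R M N} _ _ _.

(* The GNS space of the trace, which is unique up to unitary equivalence, with
   the canonical map hat : M -> L2(M) and the left multiplication operators. *)
Record L2_space (R : realType) (M : tracial_vna R) := L2Space {
  L2_sort :> hilbert R;
  hat : op M -> L2_sort;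
  hat_linear : forall (a : R[i]) x y, vna_set M x -> vna_set M y ->
    hat (a \*: x \+ y) = a *: hat x + hat y;
  hatP : forall x y, vna_set M x -> vna_set M y ->
    '[hat x, hat y] = vna_trace M (adj y \o x);
  hat_dense : forall xi (e : R), 0 < e ->
    exists2 x, vna_set M x & hnorm (xi - hat x) < e;
  lmul : op M -> op L2_sort;
  lmulP : forall x, vna_set M x ->
    bounded_op (lmul x) /\
    forall y, vna_set M y -> lmul x (hat y) = hat (x \o y) }.

Arguments hat {R M} _ _.
Arguments lmul {R M} _ _ _.

Section L2Closure.
Variables (R : realType) (M : tracial_vna R) (L : L2_space M).

(* L2(A): the closure of hat A in L2(M) *)
Definition L2_closure (A : set (op M)) : set L :=
  [set xi | forall e : R, 0 < e -> exists2 x, A x & hnorm (xi - hat L x) < e].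

(* For a von Neumann subalgebra N of M and a closed right N-submodule K of
   L2(N)^n, the orthogonal projection p onto K is an n x n matrix over N acting
   on the left, and dim K is the sum of the tau(p_ii) = <p e_i, e_i>, where e_i
   is the unit of N put at the i-th place. *)
Section Dimension.
Variables (n : nat) (K : set ('I_n -> L)).

Definition orth_proj (xi : 'I_n -> L) : 'I_n -> L :=
  xget (fun=> 0) [set eta | K eta /\
    forall kappa, K kappa -> \sum_(i < n) '[xi i - eta i, kappa i] = 0].

Definition unit_vector (i : 'I_n) : 'I_n -> L :=
  fun j => if j == i then hat L idfun else 0.

Definition vn_dim : R[i] :=
  \sum_(i < n) \sum_(j < n)
    '[orth_proj (unit_vector i) j, unit_vector i j].

End Dimension.
End L2Closure.

Arguments L2_closure {R M} _ _ _.

Section Subalgebra.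
Variables (R : realType) (M : tracial_vna R).
Implicit Types (A S : set (op M)) (x : op M).

Definition generated_by A S :=
  A = [set a | forall B, star_subalgebra B -> S `<=` B -> B a].

Definition finitely_generated A :=
  exists S, finite_set S /\ generated_by A S.

(* an enumeration, without repetition, of a finite X = X^* generating A *)
Definition selfadjoint_generators A n (X : 'I_n -> op M) :=
  [/\ injective X, (forall i, exists j, is_adjoint (X i) (X j)) &
      generated_by A (range X)].

Definition in_center A x := A x /\ forall a, A a -> x \o a = a \o x.

(* The compactly supported probability measure on the complex plane, identified
   with R * R, whose *-moments are those of x. *)
Definition spectral_distribution x
    (mu : probability (measurableTypeR R * measurableTypeR R)%type R) :=
  (exists r : R, mu (`[- r, r] `*` `[- r, r]) = 1%E) /\
  forall m k : nat,
    let mom (z : R * R) : R[i] :=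
      (z.1 +i* z.2) ^+ m * Num.conj (z.1 +i* z.2) ^+ k in
    vna_trace M (iter m x \o iter k (adj x)) =
      (\int[mu]_z complex.Re (mom z)) +i* (\int[mu]_z complex.Im (mom z)).

Definition diffuse x :=
  x \o adj x = adj x \o x /\
  exists mu, spectral_distribution x mu /\ forall z, mu [set z] = 0%E.

End Subalgebra.

Section Derivations.
Variables (R : realType) (M : tracial_vna R).
Variables (W : tensor_vna M (opposite_vna M)) (LW : L2_space W).
Variables (LM : L2_space M) (A : set (op M)).
Implicit Types (delta : op M -> LW) (x y : op M) (xi : LW).

(* x (x) y^o, the opposite of y being the operator adj y *)
Definition tensor_opp x y : op W := pure_op W x (adj y).

Definition alg_tensor : set (op W) :=
  [set f | exists n (x y : 'I_n -> op M),
    [/\ forall i, A (x i), forall i, A (y i) &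
        f = fun w => \sum_(i < n) tensor_opp (x i) (y i) w]].

Definition bimod x xi y : LW := lmul LW (tensor_opp x y) xi.

(* Only the restriction of delta to A is meaningful. *)
Definition derivation delta :=
  [/\ forall x, A x -> L2_closure LW alg_tensor (delta x),
      forall (a : R[i]) x y, A x -> A y ->
        delta (a \*: x \+ y) = a *: delta x + delta y &
      forall x y, A x -> A y ->
        delta (x \o y) = bimod x (delta y) idfun + bimod idfun (delta x) y].

(* 1 (x) 1 lies in the domain of the adjoint of delta : L2(A) -> L2(A (x) A^o),
   defined on A *)
Definition unit_in_dom_adjoint delta :=
  exists2 zeta : LM, L2_closure LM A zeta &
    forall x, A x ->
      '[delta x, hat LW (tensor_opp idfun idfun)] = '[hat LM x, zeta].

Definition Der11 delta := derivation delta /\ unit_in_dom_adjoint delta.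

Section Generators.
Variables (n : nat) (X : 'I_n -> op M).

Definition phi delta : 'I_n -> LW := fun i => delta (X i).

Definition der_norm delta : R := Num.sqrt (\sum_(i < n) hnorm (phi delta i) ^+ 2).

Definition closure_Der11 delta :=
  derivation delta /\
  forall e : R, 0 < e ->
    exists2 delta', Der11 delta' & der_norm (delta \- delta') < e.

Definition free_stein_dim : R[i] := vn_dim (phi @` [set d | closure_Der11 d]).

End Generators.
End Derivations.

(* Main.v *)
Require Import Defs.
From HB Require Import structures.
From mathcomp Require Import all_boot all_order all_algebra.
From mathcomp Require Import all_classical all_reals all_analysis.
From mathcomp Require Import measurable_realfun.
From mathcomp.real_closed Require Import complex.
From mathcomp Require Import ring lra zify.

Set Implicit Arguments.
Unset Strict Implicit.
Unset Printing Implicit Defensive.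
Import Order.TTheory GRing.Theory Num.Theory numFieldNormedType.Exports.
Local Open Scope classical_set_scope.
Local Open Scope complex_scope.
Local Open Scope ring_scope.

Local Notation "x %:C" := (real_complex _ x) : ring_scope.

(* For a in A let D_a = a (x) 1 - 1 (x) a^o, acting on the left of L2(W).  The
   inner derivations a |-> D_a xi with xi in A (x) A^o satisfy the domain
   condition, and D_z is injective because z is diffuse.  Let X be the generators
   and grad xi = (D_x xi)_(x in X), an injective bounded map.

   Since z is central, D_z delta(a) = D_a delta(z) for every derivation delta, so
   D_z maps phi_X(delta) to grad (delta z).  This forces phi_X(delta) to lie in
   the closure of the range of grad, which is therefore the module whose
   dimension is sought.  The Landweber iteration for grad converges to the
   projection onto that closure and involves only polynomials in the D_x and
   their adjoints.  Hence the trace property turns the trace of the k-th iterate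
   into 1 - <(1 - grad* grad / c)^k 1, 1>, which tends to 1 by injectivity of grad.

   Injectivity of D_z: the moments of (1 - D_z* D_z / c)^k at 1 are the integrals
   of (1 - |s - t|^2 / c)^k over mu x mu, where mu is the distribution of z; they
   tend to (mu x mu)(s = t) = 0 because mu has no atoms. *)

(** * Hilbert spaces *)

(** The projection onto the closure of the range of [grad] would ordinarily come from a spectral or
    polar decomposition. Two demands shape its replacement: membership in the closure of [Der11] has
    to be exhibited by derivations satisfying the domain condition, and the trace property concerns
    elements of W, not arbitrary vectors of L2(W). Polynomial iterates started at unit vectors meet
    both: they stay in the image of A (x) A^o and are classes of elements of W. They converge in
    norm because, for a positive contraction B, the moments [<B^k u, u>] decrease and express the
    distances between iterates.

    The same iteration settles the injectivity of [D_z]. Its powers are tested against the vector 1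
    only, where the product trace makes z (x) 1 and 1 (x) z^o independent; right multiplication then
    spreads the conclusion from 1 to a dense subspace.

    The number of generators drops out of the result: the diagonal sum of the traces of
    [D_i p D_i^*] is the trace of [p L], where L is the sum of the [D_i^* D_i]. *)

Section HilbertBasics.
Variables (R : realType) (H : hilbert R).
Implicit Types (u v w : H) (c : R).

(** Norms, Cauchy-Schwarz and limits are handled with this real form; [Im_dot] recovers the complex
    one from it. *)
Definition rdot u v : R := complex.Re '[u, v].

Lemma hdotC u v : '[v, u] = Num.conj '[u, v].
Proof. by rewrite [LHS]hermC expr0 mul1r. Qed.

Lemma Re_conj (z : R[i]) : complex.Re (Num.conj z) = complex.Re z.
Proof. by case: z. Qed.

Lemma rdotC u v : rdot u v = rdot v u.
Proof. by rewrite /rdot (hdotC v) Re_conj. Qed.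

Lemma cReD (z w : R[i]) : complex.Re (z + w) = complex.Re z + complex.Re w.
Proof. by case: z; case: w. Qed.

Lemma cReN (z : R[i]) : complex.Re (- z) = - complex.Re z.
Proof. by case: z. Qed.

Lemma cReZ c (z : R[i]) : complex.Re (c%:C * z) = c * complex.Re z.
Proof. by case: z => a b; rewrite /= mul0r subr0. Qed.

Lemma rdotDl u v w : rdot (u + v) w = rdot u w + rdot v w.
Proof. by rewrite /rdot linearDl cReD. Qed.

Lemma rdotDr u v w : rdot u (v + w) = rdot u v + rdot u w.
Proof. by rewrite /rdot linearDr cReD. Qed.

Lemma rdotNl u v : rdot (- u) v = - rdot u v.
Proof. by rewrite /rdot linearNl cReN. Qed.

Lemma rdotNr u v : rdot u (- v) = - rdot u v.
Proof. by rewrite /rdot linearNr cReN. Qed.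

Lemma rdotZl c u v : rdot (c%:C *: u) v = c * rdot u v.
Proof. by rewrite /rdot linearZl_LR cReZ. Qed.

Lemma rdotZr c u v : rdot u (c%:C *: v) = c * rdot u v.
Proof. by rewrite rdotC rdotZl rdotC. Qed.

Lemma dot_ge0 u : 0 <= '[u, u].
Proof. exact: dnorm_ge0. Qed.

Lemma rdot_ge0 u : 0 <= rdot u u.
Proof.
by have := dot_ge0 u; rewrite /rdot; case: ('[u, u]) => a b; rewrite lecE /= => /andP[].
Qed.

Lemma dot_rdot u : '[u, u] = (rdot u u)%:C.
Proof.
have := dot_ge0 u; rewrite /rdot; case: ('[u, u]) => a b.
by rewrite lecE /= => /andP[/eqP -> _].
Qed.

Lemma hnorm_ge0 u : 0 <= hnorm u.
Proof. exact: sqrtr_ge0. Qed.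

Lemma hnorm_sq u : hnorm u ^+ 2 = rdot u u.
Proof. by rewrite sqr_sqrtr //; exact: rdot_ge0. Qed.

Lemma hnorm_eq0 u : hnorm u = 0 -> u = 0.
Proof.
move=> h; apply/eqP; rewrite -(dnorm_eq0 (hdot H)); apply/eqP.
by rewrite dot_rdot -hnorm_sq h expr0n.
Qed.

Lemma hnorm0 : hnorm (0 : H) = 0.
Proof.
by rewrite /hnorm /form_norm linear0l /= sqrtr0.
Qed.

Lemma hnorm_scale (a : R[i]) u :
  hnorm (a *: u) = Num.sqrt (complex.Re a ^+ 2 + complex.Im a ^+ 2) * hnorm u.
Proof.
apply/eqP; rewrite -(@eqrXn2 _ 2) ?mulr_ge0 ?hnorm_ge0 ?sqrtr_ge0 //.
rewrite exprMn !hnorm_sq sqr_sqrtr ?addr_ge0 ?sqr_ge0 // /rdot.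
rewrite dnormZ normCK dot_rdot; case: a => x y /=.
by apply/eqP; rewrite /conj /=; ring.
Qed.

Lemma rdot_sqr_le u v : rdot u v ^+ 2 <= rdot u u * rdot v v.
Proof.
have [v0|v0] := eqVneq (rdot v v) 0.
  have /hnorm_eq0 -> : hnorm v = 0 by rewrite /hnorm /form_norm -/(rdot v v) v0 sqrtr0.
  by rewrite /rdot linear0r linear0r /= expr0n /= mulr0.
have vp : 0 < rdot v v by rewrite lt_neqAle eq_sym v0 rdot_ge0.
(* This vector is [rdot v v] times the component of u orthogonal to v, so its squared norm is
   [d * (a * d - b ^+ 2)] in the notation below. *)
have := rdot_ge0 ((rdot v v)%:C *: u - (rdot u v)%:C *: v).
rewrite !(rdotDl, rdotDr, rdotNl, rdotNr, rdotZl, rdotZr) (rdotC v u).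
set a := rdot u u; set b := rdot u v; set d := rdot v v => h.
rewrite -(ler_pM2l vp); move: h; rewrite -/d; nra.
Qed.

Lemma rdot_le u v : rdot u v <= hnorm u * hnorm v.
Proof.
rewrite (le_trans (ler_norm _)) // -(@ler_pXn2r _ 2) ?nnegrE ?mulr_ge0 ?hnorm_ge0 //.
by rewrite real_normK ?num_real // exprMn !hnorm_sq rdot_sqr_le.
Qed.

Lemma rdot_norm_le u v : `|rdot u v| <= hnorm u * hnorm v.
Proof.
rewrite ler_norml rdot_le andbT lerNl -rdotNl.
by rewrite (le_trans (rdot_le _ _)) // /hnorm /form_norm linearNl linearNr opprK.
Qed.

Lemma hnorm_opp u : hnorm (- u) = hnorm u.
Proof. by rewrite /hnorm /form_norm linearNl linearNr opprK. Qed.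

Lemma hnorm_sub u v : hnorm (u - v) = hnorm (v - u).
Proof. by rewrite -hnorm_opp opprB. Qed.

Lemma hnorm_triangle u v : hnorm (u + v) <= hnorm u + hnorm v.
Proof.
rewrite -(@ler_pXn2r _ 2) ?nnegrE ?addr_ge0 ?hnorm_ge0 //.
rewrite hnorm_sq !(rdotDl, rdotDr) (rdotC v u) -!hnorm_sq.
have := rdot_le u v; nra.
Qed.

Lemma ler_hnorm_le u v : rdot u u <= rdot v v -> hnorm u <= hnorm v.
Proof. by move=> h; rewrite -(@ler_pXn2r _ 2) ?nnegrE ?hnorm_ge0 // !hnorm_sq. Qed.

End HilbertBasics.

(** * Norm convergence in a Hilbert space *)

Section HilbertLimits.
Variables (R : realType) (H : hilbert R).
Implicit Types (u v w : H) (c : R) (x y : nat -> H).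

Definition hcvg (x : nat -> H) u := hnorm (x k - u) @[k --> \oo] --> (0 : R).

Lemma squeeze0 (a b : nat -> R) : (forall k, 0 <= a k <= b k) ->
  b k @[k --> \oo] --> (0 : R) -> a k @[k --> \oo] --> (0 : R).
Proof.
move=> ab b0; apply: (@squeeze_cvgr _ _ _ _ (fun=> 0) b) => //; last exact: cvg_cst.
by near=> k; exact: ab.
Unshelve. all: by end_near.
Qed.

Lemma hcvgP x u : hcvg x u <-> forall e : R, 0 < e -> exists N : nat,
  forall n : nat, (N <= n)%N -> hnorm (x n - u) < e.
Proof.
split.
  move=> /cvgrPdist_lt h e /h[N _ Nh]; exists N => k /Nh /=.
  by rewrite sub0r normrN ger0_norm ?hnorm_ge0.
move=> h; apply/cvgrPdist_lt => e /h[N Nh]; exists N => // k /Nh /=.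
by rewrite sub0r normrN ger0_norm ?hnorm_ge0.
Qed.

Lemma hcvg_cst u : hcvg (fun=> u) u.
Proof. by apply/hcvgP => e e0; exists 0%N => k _; rewrite subrr hnorm0. Qed.

Lemma hcvg_unique x u v : hcvg x u -> hcvg x v -> u = v.
Proof.
move=> xu xv; apply/eqP; rewrite -subr_eq0; apply/eqP/hnorm_eq0.
have h : hnorm (u - v) @[_ --> \oo] --> (0 : R).
  apply: (@squeeze0 _ (fun k => hnorm (x k - u) + hnorm (x k - v))) => [k|].
    rewrite hnorm_ge0 (hnorm_sub (x k)) (le_trans _ (hnorm_triangle _ _)) //.
    by rewrite addrA subrK.
  by rewrite -[X in _ --> X]addr0; exact: cvgD.
by apply: cvg_unique h; [exact: norm_hausdorff|exact: cvg_cst].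
Qed.

Lemma hcvgD x y u v : hcvg x u -> hcvg y v -> hcvg (fun k => x k + y k) (u + v).
Proof.
move=> xu yv; apply: (@squeeze0 _ (fun k => hnorm (x k - u) + hnorm (y k - v))).
  by move=> k; rewrite hnorm_ge0 (le_trans _ (hnorm_triangle _ _)) // opprD addrACA.
by rewrite -[X in _ --> X]addr0; exact: cvgD.
Qed.

Lemma hcvg_ext x y u : hcvg x u -> (forall k, x k = y k) -> hcvg y u.
Proof. by move=> xu /funext <-. Qed.

Lemma hcvg_lip (K : hilbert R) (f : H -> K) c x u :
  (forall v w, hnorm (f v - f w) <= c * hnorm (v - w)) ->
  hcvg x u -> hnorm (f (x k) - f u) @[k --> \oo] --> (0 : R).
Proof.
move=> fc xu; apply: (@squeeze0 _ (fun k => c * hnorm (x k - u))).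
  by move=> k; rewrite hnorm_ge0 fc.
by rewrite -[X in _ --> X](mulr0 c); exact: cvgM (cvg_cst _) xu.
Qed.

Lemma hcvgZ (a : R[i]) x u : hcvg x u -> hcvg (fun k => a *: x k) (a *: u).
Proof.
apply: (@hcvg_lip H (fun w => a *: w)
  (Num.sqrt (complex.Re a ^+ 2 + complex.Im a ^+ 2))).
by move=> v w; rewrite -scalerBr hnorm_scale.
Qed.

Lemma hcvgB x y u v : hcvg x u -> hcvg y v -> hcvg (fun k => x k - y k) (u - v).
Proof.
move=> xu /(hcvgZ (-1)) yv; have := hcvgD xu yv.
by rewrite scaleN1r; under [X in hcvg X]eq_fun do rewrite scaleN1r.
Qed.

Lemma hcvg_rdot x u v : hcvg x u -> rdot (x k) v @[k --> \oo] --> rdot u v.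
Proof.
move=> xu; apply/subr_cvg0/norm_cvg0P.
apply: (@squeeze0 _ (fun k => hnorm (x k - u) * hnorm v)).
  move=> k; rewrite normr_ge0 /= -rdotNl -rdotDl; exact: rdot_norm_le.
by rewrite -[X in _ --> X](mul0r (hnorm v)); exact: cvgM xu (cvg_cst _).
Qed.

Lemma hcvg_cauchy x :
  (forall e : R, 0 < e -> exists N : nat, forall m n : nat,
     (N <= m)%N -> (N <= n)%N -> hnorm (x m - x n) < e) ->
  exists u, hcvg x u.
Proof. by move=> /hilbert_complete[u xu]; exists u; apply/hcvgP. Qed.

Lemma hcvg_is_cauchy x u : hcvg x u ->
  forall e : R, 0 < e -> exists N : nat, forall m n : nat,
     (N <= m)%N -> (N <= n)%N -> hnorm (x m - x n) < e.
Proof.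
move=> /hcvgP xu e e0; have [N Nh] := xu (e / 2) (divr_gt0 e0 (ltr0n _ 2)).
exists N => m n /Nh hm /Nh hn; rewrite -[x m](subrK u) -addrA.
by rewrite (le_lt_trans (hnorm_triangle _ _)) // (hnorm_sub u) [e]splitr ltrD.
Qed.

Lemma cvg_const_eq (a : nat -> R) (b d : R) :
  a k @[k --> \oo] --> b -> (forall k, a k = d) -> b = d.
Proof.
move=> ab ad; apply: (@cvg_unique R (@norm_hausdorff _ _) (a k @[k --> \oo])) => //.
by rewrite (_ : a = fun=> d); [exact: cvg_cst|apply/funext].
Qed.

Lemma Im_dot u v : complex.Im '[u, v] = rdot u ('i *: v).
Proof.
rewrite /rdot linearZr_LR /=; case: ('[u, v]) => a b /=.
by rewrite mulN1r mul0r opprK add0r.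
Qed.

End HilbertLimits.

Section HilbertMaps.
Variables (R : realType) (H K : hilbert R).

(** The sequences may live in different spaces, so one of them can be constant: this covers
    identities passing to the limit as well as limits of vectors orthogonal to [v]. *)
Lemma hcvg_dot_eq (x : nat -> H) u v (y : nat -> K) u' v' :
  hcvg x u -> hcvg y u' ->
  (forall k, '[x k, v] = '[y k, v']) -> '[u, v] = '[u', v'].
Proof.
move=> xu yu xy.
have h (w : H) (w' : K) : (forall k, rdot (x k) w = rdot (y k) w') ->
    rdot u w = rdot u' w'.
  move=> e; apply/eqP; rewrite -subr_eq0; apply/eqP.
  apply: (cvg_const_eq (cvgB (hcvg_rdot (v := w) xu) (hcvg_rdot (v := w') yu))).
  by move=> k; rewrite /= e subrr.
have h1 : complex.Re '[u, v] = complex.Re '[u', v'].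
  by apply: h => k; rewrite /rdot xy.
have h2 : complex.Im '[u, v] = complex.Im '[u', v'].
  by rewrite !Im_dot; apply: h => k; rewrite -!Im_dot xy.
by move: h1 h2; case: ('[u, v]) => a b; case: ('[u', v']) => a' b' /= -> ->.
Qed.

Lemma hcvg_map (f : H -> K) c x u : linear f ->
  (forall v, hnorm (f v) <= c * hnorm v) ->
  hcvg x u -> hcvg (fun k => f (x k)) (f u).
Proof.
move=> fl fc; apply: (@hcvg_lip _ _ _ f c) => v w.
have -> : f v - f w = f (v - w); last exact: fc.
by have := fl (-1) w v; rewrite !scaleN1r (addrC _ v) (addrC _ (f v)).
Qed.

End HilbertMaps.

(** * Adjoint pairs and the Landweber iteration *)

Section Adjoints.
Variables (R : realType).

Definition adjoint_pair (H K : hilbert R) (T : H -> K) (T' : K -> H) :=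
  forall u v, '[T u, v] = '[u, T' v].

Lemma adjoint_pair_sym (H K : hilbert R) (T : H -> K) (T' : K -> H) :
  adjoint_pair T T' -> adjoint_pair T' T.
Proof. by move=> TT' u v; rewrite hdotC -TT' -hdotC. Qed.

Lemma dot_ext (H : hilbert R) (u v : H) : (forall w, '[u, w] = '[v, w]) -> u = v.
Proof.
move=> uv; apply/eqP; rewrite -subr_eq0 -(dnorm_eq0 (hdot H)).
by rewrite linearBl /= uv subrr.
Qed.

(** Linearity is read off from [<u, T' v>], so the iteration below can be set up for adjoint pairs
    alone. *)
Lemma adjoint_pair_linear (H K : hilbert R) (T : H -> K) (T' : K -> H) :
  adjoint_pair T T' -> linear T.
Proof.
move=> TT' a u v; apply: dot_ext => w.
by rewrite TT' !linearPl /= !TT'.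
Qed.

Lemma adjoint_pair_rdot (H K : hilbert R) (T : H -> K) (T' : K -> H) u v :
  adjoint_pair T T' -> rdot (T u) v = rdot u (T' v).
Proof. by move=> TT'; rewrite /rdot TT'. Qed.

End Adjoints.

Section LinearMaps.
Variables (K : pzRingType) (U V : lmodType K) (f : U -> V).
Hypothesis f_lin : linear f.

Lemma lin0 : f 0 = 0.
Proof. by have := f_lin (-1) 0 0; rewrite scaler0 addr0 scaleN1r addNr. Qed.

Lemma linD u v : f (u + v) = f u + f v.
Proof. by have := f_lin 1 u v; rewrite !scale1r. Qed.

Lemma linZ a u : f (a *: u) = a *: f u.
Proof. by have := f_lin a u 0; rewrite lin0 !addr0. Qed.

Lemma linN u : f (- u) = - f u.
Proof. by rewrite -scaleN1r linZ scaleN1r. Qed.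

Lemma linB u v : f (u - v) = f u - f v.
Proof. by rewrite linD linN. Qed.

Lemma lin_sum I (r : seq I) (P : pred I) (F : I -> U) :
  f (\sum_(i <- r | P i) F i) = \sum_(i <- r | P i) f (F i).
Proof. exact: (big_morph f linD lin0). Qed.

End LinearMaps.

Section Landweber.
Variables (R : realType) (H K : hilbert R) (T : H -> K) (T' : K -> H) (c : R).
Hypotheses (TT' : adjoint_pair T T') (c_gt0 : 0 < c).
Hypothesis T_le : forall u, rdot (T u) (T u) <= c * rdot u u.

Let T_lin := adjoint_pair_linear TT'.
Let T'_lin := adjoint_pair_linear (adjoint_pair_sym TT').

Definition residual (v : K) : K := v - c^-1%:C *: T (T' v).

(** Gradient descent with step 1/c for half of [|v - T h|^2], started at h = 0. *)
Fixpoint landweber (v : K) k : H :=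
  if k is k'.+1
  then landweber v k' + c^-1%:C *: T' (v - T (landweber v k')) else 0.

Lemma residual_landweber v k : v - T (landweber v k) = iter k residual v.
Proof.
elim: k => [|k IHk] /=; first by rewrite lin0 // subr0.
by rewrite (linD T_lin) (linZ T_lin) opprD addrA -IHk.
Qed.

(** With x = [|T' v|^2 = <T T' v, v>], Cauchy-Schwarz gives [x^2 <= c x |v|^2], and a positive x
    cancels. *)
Lemma adjoint_le v : rdot (T' v) (T' v) <= c * rdot v v.
Proof.
set x := rdot _ _; have x0 : 0 <= x := rdot_ge0 _.
have xE : x = rdot (T (T' v)) v by rewrite (adjoint_pair_rdot _ _ TT').
have h : x ^+ 2 <= (c * x) * rdot v v.
  rewrite {1}xE (le_trans (rdot_sqr_le _ _)) //.
  by rewrite ler_wpM2r ?rdot_ge0 // T_le.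
have := rdot_ge0 v; move: h; set y := rdot v v => h y0.
have [xp|] := ltP 0 x; last by move=> ?; apply: le_trans (mulr_ge0 (ltW c_gt0) y0).
by rewrite -(ler_pM2l xp) -expr2 mulrCA mulrA.
Qed.

Lemma residual_dot u v :
  rdot (residual u) v = rdot u v - c^-1 * rdot (T' u) (T' v).
Proof.
by rewrite /residual rdotDl rdotNl rdotZl (adjoint_pair_rdot _ _ TT').
Qed.

Lemma residual_dot_ge0 u : 0 <= rdot (residual u) u.
Proof.
rewrite residual_dot subr_ge0 ler_pdivrMl //; exact: adjoint_le.
Qed.

Lemma residual_sa u v : rdot (residual u) v = rdot u (residual v).
Proof. by rewrite residual_dot [RHS]rdotC residual_dot rdotC (rdotC (T' u)). Qed.

(** This is B^2 <= B for B = 1 - T T'/c: the difference at u is 1/c times [<B u, T T' u>], which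
    equals [|T' u|^2 - |T T' u|^2 / c] and is nonnegative by the bound on T. *)
Lemma residual_sqr_le u : rdot (residual u) (residual u) <= rdot (residual u) u.
Proof.
rewrite {2}/residual rdotDr rdotNr rdotZr gerBl mulr_ge0 //.
  by rewrite invr_ge0 ltW.
rewrite -(adjoint_pair_rdot _ _ (adjoint_pair_sym TT')).
rewrite /residual (linB T'_lin) (linZ T'_lin) rdotDl rdotNl rdotZl.
rewrite (adjoint_pair_rdot (T (T' u)) _ (adjoint_pair_sym TT')).
by rewrite subr_ge0 ler_pdivrMl //; exact: T_le.
Qed.

Lemma residual_dot_le u : rdot (residual u) u <= rdot u u.
Proof.
by rewrite residual_dot gerBl mulr_ge0 ?rdot_ge0 // invr_ge0 ltW.
Qed.

Lemma residual_lin : linear residual.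
Proof.
move=> a u v; rewrite /residual T'_lin T_lin scalerDr scalerBr opprD addrACA.
by rewrite !scalerA mulrC.
Qed.

Lemma residual_contract u : hnorm (residual u) <= hnorm u.
Proof.
apply: ler_hnorm_le.
exact: le_trans (residual_sqr_le u) (residual_dot_le u).
Qed.

Lemma residual_iter_dot m k u v :
  rdot (iter m residual u) (iter k residual v) = rdot (iter (m + k) residual u) v.
Proof.
elim: k m => [|k IHk] m /=; first by rewrite addn0.
by rewrite -residual_sa -iterS IHk addSnnS.
Qed.

Let half_split k : exists j, k = (j + j)%N \/ k = (j.+1 + j)%N.
Proof.
elim: k => [|k [j [->|->]]]; first by exists 0%N; left.
  by exists j; right.
by exists j.+1; left; rewrite addnS.
Qed.

(** Self-adjointness moves half of the factors to the other side. The comparison of B^(k+1) with B^k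
    becomes B <= 1 for even k and B^2 <= B for odd k, evaluated at B^j u with j the integer half of
    k. *)
Lemma residual_decr u : {homo (fun k => rdot (iter k residual u) u) :
  m k / (m <= k)%N >-> k <= m}.
Proof.
apply: homo_leq => [m //|m k l h1 h2|k]; first exact: le_trans h2 h1.
have [j [kE|kE]] : exists j, k = (j + j)%N \/ k = (j.+1 + j)%N.
    exact: half_split.
- rewrite kE (_ : (j + j).+1 = (j.+1 + j)%N) // -!residual_iter_dot /=.
  exact: residual_dot_le.
- rewrite kE -addnS -(residual_iter_dot j.+1 j.+1) -(residual_iter_dot j.+1 j) /=.
  exact: residual_sqr_le.
Qed.

Lemma residual_ge0 u k : 0 <= rdot (iter k residual u) u.
Proof.
have [j [->|->]] : exists j, k = (j + j)%N \/ k = (j.+1 + j)%N.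
- exact: half_split.
- by rewrite -residual_iter_dot rdot_ge0.
- by rewrite -residual_iter_dot /= residual_dot_ge0.
Qed.

(** The squared distance of B^m u and B^n u is a combination of the moments of orders 2m, m + n and
    2n, which converge to a common limit; so the powers are Cauchy. Their limit w is fixed by B, and
    [<B w, w> = <w, w>] leaves [|T' w|^2 = 0]. *)
Lemma residual_cvg u : exists2 w, hcvg (fun k => iter k residual u) w & T' w = 0.
Proof.
pose a k := rdot (iter k residual u) u.
have a_cvg : cvgn a.
  apply: nonincreasing_is_cvgn; first exact: residual_decr.
  by exists 0 => _ [k _ <-]; exact: residual_ge0.
have [w uw] : exists w, hcvg (fun k => iter k residual u) w.
  apply: hcvg_cauchy => e e0.
  (* Four moments enter the squared distance, each within e^2/4 of the limit. *)
  have e40 : 0 < e ^+ 2 / 4 by rewrite divr_gt0 ?exprn_gt0.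
  have [N _ Nh] := (cvgrPdist_lt _ _).1 a_cvg _ e40.
  exists N => m n Nm Nn; rewrite -(@ltr_pXn2r _ 2) ?nnegrE ?hnorm_ge0 ?(ltW e0) //.
  rewrite hnorm_sq !(rdotDl, rdotDr, rdotNl, rdotNr) !residual_iter_dot.
  have := Nh (m + m)%N (leq_trans Nm (leq_addr _ _)).
  have := Nh (m + n)%N (leq_trans Nm (leq_addr _ _)).
  have := Nh (n + m)%N (leq_trans Nn (leq_addr _ _)).
  have := Nh (n + n)%N (leq_trans Nn (leq_addr _ _)).
  rewrite /a !ltr_norml => /andP[? ?] /andP[? ?] /andP[? ?] /andP[? ?]; lra.
exists w => //.
have Bw : hcvg (fun k => iter k.+1 residual u) (residual w).
  apply: (@hcvg_lip _ _ _ residual 1) uw => v v'.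
  by rewrite -(linB residual_lin) mul1r residual_contract.
have wE : residual w = w.
  apply: hcvg_unique Bw _; apply/hcvgP => e e0.
  have [N Nh] := (hcvgP _ _).1 uw e e0.
  by exists N => n Nn; apply: Nh; rewrite leqW.
apply: hnorm_eq0; apply/eqP; rewrite -sqrf_eq0 hnorm_sq.
have := residual_dot w w; rewrite wE => /eqP.
rewrite eq_sym -subr_eq0 addrAC subrr add0r oppr_eq0 mulf_eq0 invr_eq0.
by rewrite gt_eqF.
Qed.

(** As [T' w = 0], w is orthogonal to the range of T, so the limit [u - w] is the orthogonal
    projection of u onto the closure of that range. *)
Lemma landweber_cvg u : exists w, T' w = 0 /\
  hcvg (fun k => T (landweber u k)) (u - w).
Proof.
have [w uw w0] := residual_cvg u; exists w; split => //.
have := hcvgB (hcvg_cst u) uw; congr (hcvg _ _); apply/funext => k.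
by rewrite -residual_landweber opprB addrC subrK.
Qed.

End Landweber.

(** * Finite direct sums *)

(** An alias of ['I_n -> H] that carries the Hilbert structure, while its elements remain the tuples
    on which [orth_proj] and [vn_dim] are defined. *)
Definition hpow_sort (R : realType) (H : hilbert R) (n : nat) : Type := 'I_n -> H.

Section DirectSum.
Variables (R : realType) (H : hilbert R) (n : nat).
Local Notation Hn := (hpow_sort H n).

HB.instance Definition _ := GRing.Lmodule.copy Hn ('I_n -> H).

Definition hpow_dot (f g : Hn) : R[i] := \sum_(i < n) '[f i, g i].

Lemma hpow_dot_bilinear : bilinear_for *%R (Num.conj \; *%R) hpow_dot.
Proof.
split=> [v a f g|v a f g]; rewrite /hpow_dot /= mulr_sumr -big_split /=;
  apply: eq_bigr => i _.
  by rewrite linearPl.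
by rewrite linearPr.
Qed.

HB.instance Definition _ := bilinear_isBilinear.Build R[i] Hn
  Hn R[i] *%R (Num.conj \; *%R) hpow_dot hpow_dot_bilinear.

Lemma hpow_dot_hermitian (f g : Hn) :
  hpow_dot f g = (-1) ^+ false * Num.conj (hpow_dot g f).
Proof.
rewrite expr0 mul1r /hpow_dot rmorph_sum /=.
by apply: eq_bigr => i _; rewrite -hdotC.
Qed.

HB.instance Definition _ := isHermitianSesquilinear.Build R[i] Hn
  false Num.conj hpow_dot hpow_dot_hermitian.

Lemma hpow_dot_gt0 (f : Hn) : f != 0 -> 0 < hpow_dot f f.
Proof.
move=> f0; have [i fi0] : exists i, f i != 0.
  apply: contrapT => /forallNP h; move/eqP: f0; apply; apply/funext => i.
  by apply/eqP/negPn/negP; exact: h.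
rewrite /hpow_dot (bigD1 i) //= ltr_wpDr ?dnorm_gt0 //.
by apply: sumr_ge0 => j _; exact: dot_ge0.
Qed.

HB.instance Definition _ := isDotProduct.Build R[i] Hn hpow_dot
  hpow_dot_gt0.

Lemma hpow_norm (f : Hn) :
  form_norm hpow_dot f = Num.sqrt (\sum_(i < n) hnorm (f i) ^+ 2).
Proof.
rewrite /form_norm; congr Num.sqrt; rewrite /= /hpow_dot.
rewrite (big_morph (@complex.Re R) (@cReD R) (erefl : complex.Re 0 = 0)).
by apply: eq_bigr => i _; rewrite hnorm_sq.
Qed.

(** Dividing by n + 1 makes sense for n = 0 and gives a strict bound through n < (n + 1)^2. *)
Lemma sqrt_sum_sqr_lt (a : 'I_n -> R) (e : R) : (forall i, 0 <= a i < e / n.+1%:R) ->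
  0 < e -> Num.sqrt (\sum_(i < n) a i ^+ 2) < e.
Proof.
move=> ae e0; rewrite -(@ltr_pXn2r _ 2) ?nnegrE ?sqrtr_ge0 ?(ltW e0) //.
rewrite sqr_sqrtr ?sumr_ge0 // => [|i _]; last exact: sqr_ge0.
set d := e / _ in ae; have d0 : 0 < d by rewrite divr_gt0.
have eE : e = d * n.+1%:R by rewrite divfK.
apply: (@le_lt_trans _ _ (\sum_(i < n) d ^+ 2)).
  apply: ler_sum => i _; have /andP[a0 /ltW ad] := ae i.
  by rewrite ler_pXn2r ?nnegrE // ltW.
rewrite sumr_const card_ord eE; clearbody d.
rewrite exprMn -[_ *+ n]mulr_natr ltr_pM2l ?exprn_gt0 //.
rewrite -natrX ltr_nat; nia.
Qed.

Lemma hnorm_le_hpow (f : Hn) i : hnorm (f i) <= form_norm hpow_dot f.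
Proof.
rewrite hpow_norm -(@ler_pXn2r _ 2) ?nnegrE ?sqrtr_ge0 ?hnorm_ge0 //.
rewrite [leRHS]sqr_sqrtr ?sumr_ge0 // => [|j _]; last exact: sqr_ge0.
by rewrite (bigD1 i) //= lerDl sumr_ge0 // => j _; exact: sqr_ge0.
Qed.

Lemma hpow_complete (u : nat -> Hn) :
  (forall e : R, 0 < e -> exists N : nat, forall m k : nat,
     (N <= m)%N -> (N <= k)%N -> form_norm hpow_dot (u m - u k) < e) ->
  exists l, forall e : R, 0 < e -> exists N : nat, forall k : nat,
     (N <= k)%N -> form_norm hpow_dot (u k - l) < e.
Proof.
move=> uc; have ul i : exists l, hcvg (fun k => u k i) l.
  apply: hcvg_cauchy => e /uc[N Nh]; exists N => m k Nm Nk.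
  exact: le_lt_trans (hnorm_le_hpow (u m - u k) i) (Nh m k Nm Nk).
have {ul}/choice[l ul] := ul; exists l => e e0.
have en0 : 0 < e / n.+1%:R by rewrite divr_gt0.
have /choice[N Nh] : forall i, exists N, forall k, (N <= k)%N ->
    hnorm (u k i - l i) < e / n.+1%:R.
  by move=> i; have /hcvgP := ul i; exact.
exists (\max_(i < n) N i)%N => k Nk; rewrite hpow_norm.
apply: sqrt_sum_sqr_lt => // i; rewrite hnorm_ge0 /= Nh //.
exact: leq_trans (leq_bigmax i) Nk.
Qed.

Definition hpow : hilbert R := @Hilbert R Hn hpow_dot hpow_complete.

Lemma hpow_dotE (f g : hpow) : '[f, g] = \sum_(i < n) '[f i, g i].
Proof. by []. Qed.

Lemma hpow_hnorm (f : hpow) : hnorm f = Num.sqrt (\sum_(i < n) hnorm (f i) ^+ 2).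
Proof. exact: hpow_norm. Qed.

Lemma hpow_rdot (f g : hpow) : rdot f g = \sum_(i < n) rdot (f i) (g i).
Proof.
by rewrite /rdot hpow_dotE
  (big_morph (@complex.Re R) (@cReD R) (erefl : complex.Re 0 = 0)).
Qed.

End DirectSum.

(** * Tracial von Neumann algebras and their tensor products *)

Section StarSubalgebra.
Variables (R : realType) (H : hilbert R).
Implicit Types (f g : op H) (A : set (op H)).

Lemma is_adjoint_uniq f g g' : is_adjoint f g -> is_adjoint f g' -> g = g'.
Proof.
move=> fg fg'; apply/funext => u; apply: dot_ext => w.
by rewrite hdotC -fg fg' -hdotC.
Qed.

Lemma adjE f g : is_adjoint f g -> adj f = g.
Proof.
move=> fg; rewrite /adj; case: xgetP => [h _ fh|/(_ g)//].
exact: is_adjoint_uniq fh fg.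
Qed.

Lemma adj_idfun : adj idfun = idfun :> op H.
Proof. exact: adjE. Qed.

Lemma is_adjoint_comp f f' g g' : is_adjoint f f' -> is_adjoint g g' ->
  is_adjoint (f \o g) (g' \o f').
Proof. by move=> ff gg u v; rewrite /= ff gg. Qed.

Lemma is_adjoint_comb (a : R[i]) f f' g g' : is_adjoint f f' -> is_adjoint g g' ->
  is_adjoint (a \*: f \+ g) (Num.conj a \*: f' \+ g').
Proof. by move=> ff gg u v /=; rewrite linearPl linearPr /= conjCK ff gg. Qed.

Variable A : set (op H).
Hypothesis As : star_subalgebra A.

Lemma star_bounded f : A f -> bounded_op f.
Proof. by case: As => h _ _ _ _; exact: h. Qed.

Lemma star_linear f : A f -> linear f.
Proof. by move=> /star_bounded[]. Qed.

Lemma star_id : A idfun.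
Proof. by case: As. Qed.

Lemma star_comb (a : R[i]) f g : A f -> A g -> A (a \*: f \+ g).
Proof. by case: As => _ _ h _ _; exact: h. Qed.

Lemma star_comp f g : A f -> A g -> A (f \o g).
Proof. by case: As => _ _ _ h _; exact: h. Qed.

Lemma star_adjP f : A f -> is_adjoint f (adj f) /\ A (adj f).
Proof. by case: As => _ _ _ _ h /h[g Ag fg]; rewrite (adjE fg). Qed.

Lemma adjP f : A f -> is_adjoint f (adj f).
Proof. by move=> /star_adjP[]. Qed.

Lemma star_adj f : A f -> A (adj f).
Proof. by move=> /star_adjP[]. Qed.

Lemma adjK f : A f -> adj (adj f) = f.
Proof. by move=> Af; apply: adjE; apply: is_adjoint_sym; exact: adjP. Qed.

Lemma adj_comp f g : A f -> A g -> adj (f \o g) = adj g \o adj f.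
Proof. by move=> Af Ag; apply: adjE; apply: is_adjoint_comp; exact: adjP. Qed.

Lemma adj_comb (a : R[i]) f g : A f -> A g ->
  adj (a \*: f \+ g) = Num.conj a \*: adj f \+ adj g.
Proof. by move=> Af Ag; apply: adjE; apply: is_adjoint_comb; exact: adjP. Qed.

Lemma star_zero : A (fun=> 0).
Proof.
have := star_comb (-1) star_id star_id; congr A.
by apply/funext => u /=; rewrite scaleN1r addNr.
Qed.

Lemma star_scale (a : R[i]) f : A f -> A (a \*: f).
Proof.
move=> Af; have := star_comb a Af star_zero; congr A.
by apply/funext => u /=; rewrite addr0.
Qed.

Lemma star_add f g : A f -> A g -> A (f \+ g).
Proof.
move=> Af Ag; have := star_comb 1 Af Ag; congr A.
by apply/funext => u /=; rewrite scale1r.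
Qed.

Lemma star_sub f g : A f -> A g -> A (f \- g).
Proof.
move=> Af Ag; have := star_comb (-1) Ag Af; congr A.
by apply/funext => u /=; rewrite scaleN1r addrC.
Qed.

Lemma star_iter f k : A f -> A (iter k f).
Proof.
by move=> Af; elim: k => [|k IHk]; [exact: star_id|exact: star_comp Af IHk].
Qed.

Lemma star_sum I (r : seq I) (P : pred I) (F : I -> op H) :
  (forall i, P i -> A (F i)) -> A (fun u => \sum_(i <- r | P i) F i u).
Proof.
move=> AF; elim: r => [|i r IHr].
  by have := star_zero; congr A; apply/funext => u; rewrite big_nil.
case: (boolP (P i)) => Pi.
  have := star_add (AF i Pi) IHr; congr A.
  by apply/funext => u; rewrite big_cons Pi.
by have := IHr; congr A; apply/funext => u; rewrite big_cons (negPf Pi).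
Qed.

End StarSubalgebra.

Section TracialAlgebra.
Variables (R : realType) (M : tracial_vna R).
Implicit Types x y : op M.
Local Notation tau := (vna_trace M).

Lemma vna_star : star_subalgebra (vna_set M).
Proof. by case: (tracial_vnaP M) => -[]. Qed.

Lemma trace_comb (a : R[i]) x y : vna_set M x -> vna_set M y ->
  tau (a \*: x \+ y) = a * tau x + tau y.
Proof. by case: (tracial_vnaP M) => _ _ [h _ _ _] _ _; exact: h. Qed.

Lemma trace_id : tau idfun = 1.
Proof. by case: (tracial_vnaP M) => _ _ [_ h _ _] _ _. Qed.

Lemma traceC x y : vna_set M x -> vna_set M y -> tau (x \o y) = tau (y \o x).
Proof. by case: (tracial_vnaP M) => _ _ [_ _ _ h] _ _; exact: h. Qed.

Lemma trace_zero : tau (fun=> 0) = 0.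
Proof.
have Z := star_zero vna_star; have := trace_comb (-1) Z Z.
rewrite mulN1r addNr => <-; congr tau.
by apply/funext => u /=; rewrite scaler0 addr0.
Qed.

Lemma trace_sum I (r : seq I) (P : pred I) (F : I -> op M) :
  (forall i, P i -> vna_set M (F i)) ->
  tau (fun u => \sum_(i <- r | P i) F i u) = \sum_(i <- r | P i) tau (F i).
Proof.
move=> MF; elim: r => [|i r IHr].
  rewrite big_nil -trace_zero; congr tau.
  by apply/funext => u; rewrite big_nil.
rewrite big_cons -IHr; case: (boolP (P i)) => Pi.
  have := trace_comb 1 (MF i Pi) (star_sum vna_star r MF).
  rewrite mul1r => <-; congr tau.
  by apply/funext => u; rewrite big_cons Pi /= scale1r.
by congr tau; apply/funext => u; rewrite big_cons (negPf Pi).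
Qed.

End TracialAlgebra.

(** * Elementary tensors of operators *)

Section Tensor.
Variables (R : realType) (M N : tracial_vna R) (W : tensor_vna M N).
Implicit Types (x : op M) (y : op N) (f g : op W).

Lemma vna_pure_op x y : vna_set M x -> vna_set N y -> vna_set W (pure_op W x y).
Proof.
move=> Mx Ny; rewrite tensor_gen; split; first by have [] := pure_opP W Mx Ny.
by move=> g [_ gS]; apply/esym/gS; exists x => //; exists y.
Qed.

Lemma pure_opE x y u v : vna_set M x -> vna_set N y ->
  pure_op W x y (pure W u v) = pure W (x u) (y v).
Proof. by move=> Mx Ny; have [_ ->] := pure_opP W Mx Ny. Qed.

(** Totality of the pure vectors is expressed by orthogonality, so the difference is tested through
    its adjoint, whose range is orthogonal to all pure vectors. *)
Lemma pure_ext f g : vna_set W f -> vna_set W g ->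
  (forall u v, f (pure W u v) = g (pure W u v)) -> f = g.
Proof.
move=> Wf Wg fg; have Wh := star_sub (vna_star W) Wf Wg.
have h' v : adj (f \- g) v = 0.
  apply: pure_total => a b; rewrite -(adjP (vna_star W) Wh) /= fg subrr.
  by rewrite linear0l.
apply/funext => w; apply/eqP; rewrite -subr_eq0; apply/eqP.
apply: dot_ext => v; rewrite linear0l.
by have := adjP (vna_star W) Wh w v; rewrite h' linear0r.
Qed.

Lemma pure_op_comp x x' y y' : vna_set M x -> vna_set M x' -> vna_set N y ->
  vna_set N y' ->
  pure_op W (x \o x') (y \o y') = pure_op W x y \o pure_op W x' y'.
Proof.
move=> Mx Mx' Ny Ny'.
have Mxx := star_comp (vna_star M) Mx Mx'.
have Nyy := star_comp (vna_star N) Ny Ny'.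
apply: pure_ext => [||u v]; first exact: vna_pure_op.
  by apply: (star_comp (vna_star W)); exact: vna_pure_op.
by rewrite /= !pure_opE.
Qed.

Lemma pure_op_id : pure_op W idfun idfun = idfun.
Proof.
have Mi := star_id (vna_star M); have Ni := star_id (vna_star N).
apply: pure_ext => [||u v]; [exact: vna_pure_op|exact: star_id (vna_star W)|].
by rewrite pure_opE.
Qed.

Lemma pure_op_combl (a : R[i]) x x' y : vna_set M x -> vna_set M x' ->
  vna_set N y ->
  pure_op W (a \*: x \+ x') y = a \*: pure_op W x y \+ pure_op W x' y.
Proof.
move=> Mx Mx' Ny; have Mc := star_comb (vna_star M) a Mx Mx'.
apply: pure_ext => [||u v]; first exact: vna_pure_op.
  by apply: (star_comb (vna_star W)); exact: vna_pure_op.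
by rewrite /= !pure_opE //= linearPl.
Qed.

Lemma pure_op_combr (a : R[i]) x y y' : vna_set M x -> vna_set N y ->
  vna_set N y' ->
  pure_op W x (a \*: y \+ y') = a \*: pure_op W x y \+ pure_op W x y'.
Proof.
move=> Mx Ny Ny'; have Nc := star_comb (vna_star N) a Ny Ny'.
apply: pure_ext => [||u v]; first exact: vna_pure_op.
  by apply: (star_comb (vna_star W)); exact: vna_pure_op.
by rewrite /= !pure_opE //= linearPr.
Qed.

Lemma pure_op_scalel (a : R[i]) x y : vna_set M x -> vna_set N y ->
  pure_op W (a \*: x) y = a \*: pure_op W x y.
Proof.
move=> Mx Ny; have Mc := star_scale (vna_star M) a Mx.
apply: pure_ext => [||u v]; first exact: vna_pure_op.
  by apply: (star_scale (vna_star W)); exact: vna_pure_op.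
by rewrite /= !pure_opE //= linearZl_LR.
Qed.

Lemma adj_pure_op x y : vna_set M x -> vna_set N y ->
  adj (pure_op W x y) = pure_op W (adj x) (adj y).
Proof.
move=> Mx Ny; have Wf := vna_pure_op Mx Ny.
have Mx' := star_adj (vna_star M) Mx; have Ny' := star_adj (vna_star N) Ny.
apply: pure_ext => [||u v]; [exact: star_adj (vna_star W) _ Wf|exact: vna_pure_op|].
apply/eqP; rewrite -subr_eq0; apply/eqP; apply: (@pure_total _ _ _ W) => u' v'.
rewrite linearBr /= -(adjP (vna_star W) Wf) !pure_opE // !pureP.
by rewrite -(adjP (vna_star M) Mx) -(adjP (vna_star N) Ny) subrr.
Qed.

End Tensor.

(** * The standard form *)

Lemma bounded_op_gt0 (R : realType) (H : hilbert R) (f : op H) : bounded_op f ->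
  exists2 c : R, 0 < c & forall u, hnorm (f u) <= c * hnorm u.
Proof.
case=> _ [c fc]; exists (Num.max c 1); first by rewrite lt_max ltr01 orbT.
move=> u; apply: le_trans (fc u) _.
by rewrite ler_wpM2r ?hnorm_ge0 // le_max lexx.
Qed.

Section StandardForm.
Variables (R : realType) (M : tracial_vna R) (L : L2_space M).
Implicit Types (x y : op M) (xi : L).
Let Ms := vna_star M.

Lemma hat_zero : hat L (fun=> 0) = 0.
Proof.
have Z := star_zero Ms; have := hat_linear L (-1) Z Z.
rewrite scaleN1r addNr => <-; congr hat.
by apply/funext => u /=; rewrite scaler0 addr0.
Qed.

Lemma hat_sub x y : vna_set M x -> vna_set M y ->
  hat L (x \- y) = hat L x - hat L y.
Proof.
move=> Mx My; have := hat_linear L (-1) My Mx; rewrite scaleN1r addrC => <-.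
by congr hat; apply/funext => u /=; rewrite scaleN1r addrC.
Qed.

Lemma hat_add x y : vna_set M x -> vna_set M y ->
  hat L (x \+ y) = hat L x + hat L y.
Proof.
move=> Mx My; have := hat_linear L 1 Mx My; rewrite scale1r => <-.
by congr hat; apply/funext => u /=; rewrite scale1r.
Qed.

Lemma hat_scale (a : R[i]) x : vna_set M x -> hat L (a \*: x) = a *: hat L x.
Proof.
move=> Mx; have := hat_linear L a Mx (star_zero Ms).
rewrite hat_zero addr0 => <-.
by congr hat; apply/funext => u /=; rewrite addr0.
Qed.

Lemma hat_sum I (r : seq I) (P : pred I) (F : I -> op M) :
  (forall i, P i -> vna_set M (F i)) ->
  hat L (fun u => \sum_(i <- r | P i) F i u) = \sum_(i <- r | P i) hat L (F i).
Proof.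
move=> MF; elim: r => [|i r IHr].
  rewrite big_nil -hat_zero; congr hat.
  by apply/funext => u; rewrite big_nil.
rewrite big_cons -IHr; case: (boolP (P i)) => Pi.
  rewrite -(hat_add (MF i Pi) (star_sum Ms r MF)); congr hat.
  by apply/funext => u; rewrite big_cons Pi.
by congr hat; apply/funext => u; rewrite big_cons (negPf Pi).
Qed.

Lemma lmul_hat x y : vna_set M x -> vna_set M y ->
  lmul L x (hat L y) = hat L (x \o y).
Proof. by move=> Mx My; have [_ ->] := lmulP L Mx. Qed.

Lemma lmul_bounded x : vna_set M x -> bounded_op (lmul L x).
Proof. by move=> Mx; have [] := lmulP L Mx. Qed.

Lemma lmul_lin x : vna_set M x -> linear (lmul L x).
Proof. by move=> /lmul_bounded[]. Qed.

Lemma hat_approx xi : exists2 y : nat -> op M,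
  (forall k, vna_set M (y k)) & hcvg (fun k => hat L (y k)) xi.
Proof.
have h (k : nat) : {y | vna_set M y & hnorm (xi - hat L y) < k.+1%:R^-1}.
  by apply: cid2; apply: hat_dense; rewrite invr_gt0.
exists (fun k => s2val (h k)) => [k|]; first exact: s2valP.
apply: (@squeeze0 _ _ (fun k => k.+1%:R^-1)); last exact: cvg_harmonic.
by move=> k; rewrite hnorm_ge0 hnorm_sub ltW // (s2valP' (h k)).
Qed.

Lemma hcvg_lmul x (u : nat -> L) xi : vna_set M x -> hcvg u xi ->
  hcvg (fun k => lmul L x (u k)) (lmul L x xi).
Proof.
move=> /lmul_bounded bx; have [c _ xc] := bounded_op_gt0 bx.
by apply: hcvg_map xc; case: bx.
Qed.

Lemma lmul_comp x y xi : vna_set M x -> vna_set M y ->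
  lmul L (x \o y) xi = lmul L x (lmul L y xi).
Proof.
move=> Mx My; have [z Mz zxi] := hat_approx xi.
apply: hcvg_unique (hcvg_lmul (star_comp Ms Mx My) zxi) _.
apply: hcvg_ext (hcvg_lmul Mx (hcvg_lmul My zxi)) _ => k.
by rewrite !lmul_hat //; exact: (star_comp Ms).
Qed.

Lemma lmul_id xi : lmul L idfun xi = xi.
Proof.
have [z Mz zxi] := hat_approx xi.
apply: hcvg_unique (hcvg_lmul (star_id Ms) zxi) _.
by apply: hcvg_ext zxi _ => k; rewrite lmul_hat //; exact: star_id Ms.
Qed.

Lemma lmul_comb (a : R[i]) x y xi : vna_set M x -> vna_set M y ->
  lmul L (a \*: x \+ y) xi = a *: lmul L x xi + lmul L y xi.
Proof.
move=> Mx My; have [z Mz zxi] := hat_approx xi.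
apply: hcvg_unique (hcvg_lmul (star_comb Ms a Mx My) zxi) _.
apply: hcvg_ext (hcvgD (hcvgZ a (hcvg_lmul Mx zxi)) (hcvg_lmul My zxi)) _ => k.
rewrite !lmul_hat //; last exact: (star_comb Ms).
by rewrite -hat_linear //; exact: (star_comp Ms).
Qed.

Lemma lmul_scale (a : R[i]) x xi : vna_set M x ->
  lmul L (a \*: x) xi = a *: lmul L x xi.
Proof.
move=> Mx; have Z := star_zero Ms.
have lZ : lmul L (fun=> 0) xi = 0.
  have := lmul_comb (-1) xi Z Z; rewrite scaleN1r addNr => <-.
  by congr lmul; apply/funext => u /=; rewrite scaler0 addr0.
have := lmul_comb a xi Mx Z; rewrite lZ addr0 => <-.
by congr lmul; apply/funext => u /=; rewrite addr0.
Qed.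

Lemma lmul_adjoint x : vna_set M x -> adjoint_pair (lmul L x) (lmul L (adj x)).
Proof.
move=> Mx xi eta; have [z Mz zxi] := hat_approx xi.
have [t Mt teta] := hat_approx eta; have Mx' := star_adj Ms Mx.
apply: hcvg_dot_eq (hcvg_lmul Mx zxi) zxi _ => k.
(* Conjugation exchanges the arguments, so that the limit in [eta] is again taken on the left. *)
rewrite hdotC [RHS]hdotC; congr Num.conj.
apply: hcvg_dot_eq teta (hcvg_lmul Mx' teta) _ => j.
rewrite !lmul_hat // !hatP //; try exact: (star_comp Ms).
by rewrite (adj_comp Ms) // (adjK Ms).
Qed.

Lemma hat_dot_id x : vna_set M x -> '[hat L x, hat L idfun] = vna_trace M x.
Proof. by move=> Mx; rewrite hatP ?adj_idfun //; exact: star_id Ms. Qed.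

Lemma hnorm_hat_adj x : vna_set M x -> hnorm (hat L (adj x)) = hnorm (hat L x).
Proof.
move=> Mx; have Mx' := star_adj Ms Mx.
by rewrite /hnorm /form_norm !hatP // (adjK Ms) // traceC.
Qed.

(* Right multiplication is bounded because, by the trace property, the adjoint
   is isometric on L2(M) and turns it into a left multiplication. *)
Lemma hat_comp_le y : vna_set M y -> exists2 c : R, 0 < c &
  forall x, vna_set M x -> hnorm (hat L (x \o y)) <= c * hnorm (hat L x).
Proof.
move=> My; have My' := star_adj Ms My.
have [c c0 yc] := bounded_op_gt0 (lmul_bounded My'); exists c => // x Mx.
have Mx' := star_adj Ms Mx; have Mxy := star_comp Ms Mx My.
have -> : hnorm (hat L (x \o y)) = hnorm (lmul L (adj y) (hat L (adj x))).
  by rewrite (lmul_hat My' Mx') -(adj_comp Ms Mx My) (hnorm_hat_adj Mxy).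
by rewrite -(hnorm_hat_adj Mx); exact: yc.
Qed.

End StandardForm.

(** * Expectations of bounded complex random variables *)

Lemma cReM (R : realType) (z w : R[i]) : complex.Re (z * w) =
  complex.Re z * complex.Re w - complex.Im z * complex.Im w.
Proof. by case: z; case: w. Qed.

Lemma cImM (R : realType) (z w : R[i]) : complex.Im (z * w) =
  complex.Re z * complex.Im w + complex.Im z * complex.Re w.
Proof. by case: z; case: w. Qed.

Lemma cImD (R : realType) (z w : R[i]) : complex.Im (z + w) = complex.Im z + complex.Im w.
Proof. by case: z; case: w. Qed.

Section BoundedMeasurable.
Context d (T : measurableType d) (R : realType).
Implicit Types (F G : T -> R) (f g : T -> R[i]).

Definition bdd_meas F := measurable_fun setT F /\ exists B, forall t, `|F t| <= B.

Lemma bdd_meas_cst (a : R) : bdd_meas (fun=> a).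
Proof. by split; [exact: measurable_cst|exists `|a|]. Qed.

Lemma bdd_measD F G : bdd_meas F -> bdd_meas G -> bdd_meas (fun t => F t + G t).
Proof.
move=> [mF [B FB]] [mG [C GC]]; split; first exact: measurable_funD.
by exists (B + C) => t; rewrite (le_trans (ler_normD _ _)) // lerD.
Qed.

Lemma bdd_measM F G : bdd_meas F -> bdd_meas G -> bdd_meas (fun t => F t * G t).
Proof.
move=> [mF [B FB]] [mG [C GC]]; split; first exact: measurable_funM.
by exists (B * C) => t; rewrite normrM ler_pM.
Qed.

Lemma bdd_measN F : bdd_meas F -> bdd_meas (fun t => - F t).
Proof.
move=> /(bdd_measM (bdd_meas_cst (-1))).
by under eq_fun do rewrite mulN1r.
Qed.

Lemma bdd_measB F G : bdd_meas F -> bdd_meas G -> bdd_meas (fun t => F t - G t).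
Proof. by move=> bF bG; exact: bdd_measD bF (bdd_measN bG). Qed.

Lemma bdd_measX F k : bdd_meas F -> bdd_meas (fun t => F t ^+ k).
Proof.
move=> bF; elim: k => [|k IHk]; first exact: bdd_meas_cst.
by under eq_fun do rewrite exprS; exact: bdd_measM.
Qed.

Definition cbdd_meas f :=
  bdd_meas (fun t => complex.Re (f t)) /\ bdd_meas (fun t => complex.Im (f t)).

Lemma cbdd_meas_cst (a : R[i]) : cbdd_meas (fun=> a).
Proof. by split; exact: bdd_meas_cst. Qed.

Lemma cbdd_measD f g : cbdd_meas f -> cbdd_meas g -> cbdd_meas (fun t => f t + g t).
Proof.
move=> [f1 f2] [g1 g2]; split.
  by under eq_fun do rewrite cReD; exact: bdd_measD.
by under eq_fun do rewrite cImD; exact: bdd_measD.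
Qed.

Lemma cbdd_measM f g : cbdd_meas f -> cbdd_meas g -> cbdd_meas (fun t => f t * g t).
Proof.
move=> [f1 f2] [g1 g2]; split.
  by under eq_fun do rewrite cReM; apply: bdd_measB; exact: bdd_measM.
by under eq_fun do rewrite cImM; apply: bdd_measD; exact: bdd_measM.
Qed.

Lemma cbdd_measX f k : cbdd_meas f -> cbdd_meas (fun t => f t ^+ k).
Proof.
move=> bf; elim: k => [|k IHk]; first exact: cbdd_meas_cst.
by under eq_fun do rewrite exprS; exact: cbdd_measM.
Qed.

Lemma cbdd_meas_conj f : cbdd_meas f -> cbdd_meas (fun t => Num.conj (f t)).
Proof.
have ReC (z : R[i]) : complex.Re (Num.conj z) = complex.Re z by case: z.
have ImC (z : R[i]) : complex.Im (Num.conj z) = - complex.Im z by case: z.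
move=> [f1 f2]; split; first by under eq_fun do rewrite ReC.
by under eq_fun do rewrite ImC; exact: bdd_measN.
Qed.

Variable P : probability T R.

Lemma bdd_meas_integrable F : bdd_meas F -> P.-integrable setT (EFin \o F).
Proof.
move=> [mF [B FB]]; apply: measurable_bounded_integrable => //.
  by apply: (le_lt_trans (probability_le1 P measurableT)); rewrite ltry.
by exists B; split; [exact: num_real|move=> x Bx t _; exact: le_trans (FB t) (ltW Bx)].
Qed.

Definition cexpect f : R[i] :=
  (\int[P]_t complex.Re (f t)) +i* (\int[P]_t complex.Im (f t)).

Lemma cexpect_comb (a : R[i]) f g : cbdd_meas f -> cbdd_meas g ->
  cexpect (fun t => a * f t + g t) = a * cexpect f + cexpect g.
Proof.
move=> [f1 f2] [g1 g2]; rewrite /cexpect.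
have i F : bdd_meas F -> P.-integrable setT (EFin \o F) by exact: bdd_meas_integrable.
have iM b F : bdd_meas F -> P.-integrable setT (EFin \o (fun t => b * F t)).
  by move=> bF; apply: i; apply: bdd_measM bF; exact: bdd_meas_cst.
under eq_Rintegral do rewrite cReD cReM.
under [X in _ +i* X]eq_Rintegral do rewrite cImD cImM.
case: a => a b /=.
have bM (c : R) F : bdd_meas F -> bdd_meas (fun t => c * F t).
  by move=> bF; apply: bdd_measM bF; exact: bdd_meas_cst.
apply/eqP; rewrite eq_complex /=; apply/andP; split; apply/eqP.
  rewrite RintegralD //; [|by apply: i; apply: bdd_measB; exact: bM|exact: i].
  by rewrite RintegralB // ?RintegralZl //; [exact: i|exact: i|exact: iM|exact: iM].
rewrite RintegralD //; [|by apply: i; apply: bdd_measD; exact: bM|exact: i].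
by rewrite RintegralD // ?RintegralZl //; [exact: i|exact: i|exact: iM|exact: iM].
Qed.

(* The powers of a function with values in [0, 1] decrease to the indicator of
   the set where it takes the value 1. *)
Lemma Rintegral_powers_cvg0 F : bdd_meas F -> (forall t, 0 <= F t <= 1) ->
  P [set t | F t = 1] = 0%E ->
  (\int[P]_t (F t ^+ k)) @[k --> \oo] --> (0 : R).
Proof.
move=> bF F01 P0; have mF := bF.1.
have mS : measurable [set t | F t = 1].
  rewrite (_ : [set t | F t = 1] = setT `&` F @^-1` [set 1]); last first.
    by rewrite setTI.
  by apply: mF => //; exact: measurable_set1.
pose S := [set t | F t = 1].
have [_ _ h] : [/\ P.-integrable setT (EFin \o \1_S : T -> \bar R),
  [sequence \int[P]_(t in setT) `|(F t ^+ k)%:E - (\1_S t)%:E| ]_k @ \oo --> 0%E &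
  [sequence \int[P]_(t in setT) (F t ^+ k)%:E ]_k @ \oo -->
     (\int[P]_(t in setT) (\1_S t)%:E)]%E.
  apply: (@dominated_convergence _ _ _ P setT measurableT
    (fun k t => (F t ^+ k)%:E) (EFin \o \1_S) (fun=> 1%E)).
  - by move=> k; apply/measurable_EFinP; exact: (bdd_measX k bF).1.
  - by apply/measurable_EFinP; exact: measurable_indic.
  - apply: aeW => t _; apply/fine_cvgP => /=; split; first exact: nearW.
    rewrite /= indicE; case: (boolP (t \in S)) => [|tS].
      rewrite inE => -> /=; under eq_fun do rewrite expr1n; exact: cvg_cst.
    have /andP[F0 F1] := F01 t; apply: cvg_expr; rewrite ger0_norm // lt_neqAle F1.
    by rewrite andbT; apply/eqP => F1'; move/negP: tS; apply; rewrite inE.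
  - exact: (bdd_meas_integrable (bdd_meas_cst 1)).
  - apply: aeW => t k _; have /andP[F0 F1] := F01 t.
    by rewrite lee_fin ger0_norm ?exprn_ge0 // exprn_ile1.
move: h; rewrite (_ : (\int[P]_(t in setT) (\1_S t)%:E = 0)%E); last first.
  by rewrite integral_indic // setIT.
by move=> /fine_cvgP[].
Qed.

End BoundedMeasurable.

Section ProductExpectation.
Context d1 d2 (T1 : measurableType d1) (T2 : measurableType d2) (R : realType).
Variables (P1 : probability T1 R) (P2 : probability T2 R).

Lemma bdd_meas_fst (F : T1 -> R) : bdd_meas F ->
  bdd_meas (fun t : T1 * T2 => F t.1).
Proof.
move=> [mF [B FB]]; split; last by exists B => t; exact: FB.
exact: measurableT_comp mF measurable_fst.
Qed.

Lemma bdd_meas_snd (F : T2 -> R) : bdd_meas F ->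
  bdd_meas (fun t : T1 * T2 => F t.2).
Proof.
move=> [mF [B FB]]; split; last by exists B => t; exact: FB.
exact: measurableT_comp mF measurable_snd.
Qed.

Lemma Rintegral_prod (F : T1 -> R) (G : T2 -> R) : bdd_meas F -> bdd_meas G ->
  \int[(P1 \x P2)%E]_t (F t.1 * G t.2) = \int[P1]_t F t * \int[P2]_t G t.
Proof.
move=> bF bG; have iF := bdd_meas_integrable P1 bF.
have iG := bdd_meas_integrable P2 bG.
have bFG := bdd_measM (bdd_meas_fst bF) (bdd_meas_snd bG).
rewrite /Rintegral -integral12_prod_meas1; last exact: bdd_meas_integrable bFG.
have cE : (\int[P2]_t (G t)%:E = (\int[P2]_t G t)%:E)%E.
  by rewrite fineK //; exact: (integrable_fin_num measurableT iG).
rewrite /fubini_F /=.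
under eq_integral do under eq_integral do rewrite EFinM.
under eq_integral do rewrite integralZl // cE.
rewrite integralZr // fineM //; exact: (integrable_fin_num measurableT iF).
Qed.

Lemma cbdd_meas_fst (f : T1 -> R[i]) : cbdd_meas f ->
  cbdd_meas (fun t : T1 * T2 => f t.1).
Proof. by move=> [f1 f2]; split; [exact: (bdd_meas_fst f1)|exact: (bdd_meas_fst f2)]. Qed.

Lemma cbdd_meas_snd (f : T2 -> R[i]) : cbdd_meas f ->
  cbdd_meas (fun t : T1 * T2 => f t.2).
Proof. by move=> [f1 f2]; split; [exact: (bdd_meas_snd f1)|exact: (bdd_meas_snd f2)]. Qed.

Lemma cexpect_prod (f : T1 -> R[i]) (g : T2 -> R[i]) : cbdd_meas f -> cbdd_meas g ->
  cexpect (P1 \x P2)%E (fun t => f t.1 * g t.2) = cexpect P1 f * cexpect P2 g.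
Proof.
move=> [f1 f2] [g1 g2]; rewrite /cexpect.
under eq_Rintegral do rewrite cReM.
under [X in _ +i* X]eq_Rintegral do rewrite cImM.
have bM (F : T1 -> R) (G : T2 -> R) (bF : bdd_meas F) (bG : bdd_meas G) :=
  bdd_meas_integrable (P1 \x P2)%E (bdd_measM (bdd_meas_fst bF) (bdd_meas_snd bG)).
apply/eqP; rewrite eq_complex /=; apply/andP; split; apply/eqP.
  rewrite RintegralB //; [|exact: bM f1 g1|exact: bM f2 g2].
  by rewrite (Rintegral_prod f1 g1) (Rintegral_prod f2 g2).
rewrite RintegralD //; [|exact: bM f1 g2|exact: bM f2 g1].
by rewrite (Rintegral_prod f1 g2) (Rintegral_prod f2 g1).
Qed.

End ProductExpectation.

(** * Commutators with algebra elements *)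

Section Bimodule.
Variables (R : realType) (M : tracial_vna R).
Variables (W : tensor_vna M (opposite_vna M)) (LW : L2_space W).
Implicit Types (x y : op M) (xi : LW).
Local Notation tau := (vna_trace M).
Let Ms := vna_star M.
Let Ws := vna_star W.
Local Notation tensor_opp := (@tensor_opp R M W).

Lemma vna_tensor_opp x y : vna_set M x -> vna_set M y ->
  vna_set W (tensor_opp x y).
Proof. by move=> Mx My; apply: vna_pure_op => //; exact: (star_adj Ms My). Qed.

Lemma tensor_opp_id : tensor_opp idfun idfun = idfun.
Proof. by rewrite /tensor_opp adj_idfun; exact: pure_op_id. Qed.

Lemma tensor_opp_comp x x' y y' : vna_set M x -> vna_set M x' ->
  vna_set M y -> vna_set M y' ->
  tensor_opp x y \o tensor_opp x' y' = tensor_opp (x \o x') (y' \o y).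
Proof.
move=> Mx Mx' My My'; rewrite /tensor_opp (adj_comp Ms) //.
by rewrite -pure_op_comp //; exact: (star_adj Ms).
Qed.

Lemma adj_tensor_opp x y : vna_set M x -> vna_set M y ->
  adj (tensor_opp x y) = tensor_opp (adj x) (adj y).
Proof.
move=> Mx My; rewrite /tensor_opp adj_pure_op //; last exact: (star_adj Ms).
by rewrite conj_adj.
Qed.

Lemma tensor_opp_combl (a : R[i]) x x' y : vna_set M x -> vna_set M x' ->
  vna_set M y -> tensor_opp (a \*: x \+ x') y =
    a \*: tensor_opp x y \+ tensor_opp x' y.
Proof.
by move=> Mx Mx' My; apply: pure_op_combl => //; exact: (star_adj Ms).
Qed.

(** The adjoint is antilinear and the scalars of the conjugate space are conjugated; the two
    conjugations cancel. *)
Lemma tensor_opp_combr (a : R[i]) x y y' : vna_set M x -> vna_set M y ->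
  vna_set M y' -> tensor_opp x (a \*: y \+ y') =
    a \*: tensor_opp x y \+ tensor_opp x y'.
Proof.
move=> Mx My My'; rewrite /tensor_opp (adj_comb Ms) //.
by apply: (@pure_op_combr _ _ _ W a) => //; exact: (star_adj Ms).
Qed.

Lemma bimod_bimod x x' y y' xi : vna_set M x -> vna_set M x' ->
  vna_set M y -> vna_set M y' ->
  bimod x (bimod x' xi y') y = bimod (x \o x') xi (y' \o y).
Proof.
move=> Mx Mx' My My'.
by rewrite /bimod -tensor_opp_comp // lmul_comp //; exact: vna_tensor_opp.
Qed.

Lemma bimod_scalel (a : R[i]) x y xi : vna_set M x -> vna_set M y ->
  bimod (a \*: x) xi y = a *: bimod x xi y.
Proof.
move=> Mx My; rewrite /bimod -lmul_scale; last exact: vna_tensor_opp.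
by rewrite /tensor_opp pure_op_scalel //; exact: (star_adj Ms My).
Qed.

Lemma bimod_id xi : bimod idfun xi idfun = xi.
Proof. by rewrite /bimod tensor_opp_id lmul_id. Qed.

Lemma bimod_lin x y : vna_set M x -> vna_set M y ->
  linear (fun xi : LW => bimod x xi y).
Proof. by move=> Mx My; apply: lmul_lin; exact: vna_tensor_opp. Qed.

Lemma hcvg_bimod x y (u : nat -> LW) xi : vna_set M x -> vna_set M y ->
  hcvg u xi -> hcvg (fun k => bimod x (u k) y) (bimod x xi y).
Proof. by move=> Mx My; apply: hcvg_lmul; exact: vna_tensor_opp. Qed.

Local Notation one := (hat LW idfun).

(** This is the [D_x] of the overview as an element of W. Its action on L2(W) is [commutator], kept
    in bimodule form for the Leibniz rule. *)
Definition commutator_op x : op W := tensor_opp x idfun \- tensor_opp idfun x.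

Definition commutator x xi : LW := bimod x xi idfun - bimod idfun xi x.

Lemma vna_commutator x : vna_set M x -> vna_set W (commutator_op x).
Proof.
move=> Mx; have Mi := star_id Ms.
by apply: (star_sub Ws); exact: vna_tensor_opp.
Qed.

Lemma lmul_sub (f g : op W) xi : vna_set W f -> vna_set W g ->
  lmul LW (f \- g) xi = lmul LW f xi - lmul LW g xi.
Proof.
move=> Wf Wg; have := lmul_comb (-1) xi Wg Wf; rewrite scaleN1r addrC => <-.
by congr lmul; apply/funext => u /=; rewrite scaleN1r addrC.
Qed.

Lemma commutatorE x xi : vna_set M x ->
  commutator x xi = lmul LW (commutator_op x) xi.
Proof.
move=> Mx; have Mi := star_id Ms.
by rewrite /commutator_op lmul_sub //; exact: vna_tensor_opp.
Qed.

Lemma adj_commutator x : vna_set M x ->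
  adj (commutator_op x) = commutator_op (adj x).
Proof.
move=> Mx; have Mi := star_id Ms.
have Wl := vna_tensor_opp Mx Mi; have Wr := vna_tensor_opp Mi Mx.
have -> : commutator_op x = -1 \*: tensor_opp idfun x \+ tensor_opp x idfun.
  by apply/funext => u /=; rewrite scaleN1r addrC.
rewrite (adj_comb Ws) // !adj_tensor_opp // adj_idfun.
by apply/funext => u /=; rewrite rmorphN1 scaleN1r addrC.
Qed.

Lemma commutator_adjoint x : vna_set M x ->
  adjoint_pair (commutator x) (commutator (adj x)).
Proof.
move=> Mx xi eta; rewrite !commutatorE //; last exact: (star_adj Ms).
by rewrite (lmul_adjoint (vna_commutator Mx)) adj_commutator.
Qed.

Lemma commutator_lin x : vna_set M x -> linear (commutator x).
Proof. by move=> /commutator_adjoint /adjoint_pair_linear. Qed.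

Lemma commutator_bounded x : vna_set M x -> exists2 c : R, 0 < c &
  forall xi, hnorm (commutator x xi) <= c * hnorm xi.
Proof.
move=> Mx; have [c c0 h] := bounded_op_gt0 (lmul_bounded LW (vna_commutator Mx)).
by exists c => // xi; rewrite commutatorE.
Qed.

Lemma commutator_comb (a : R[i]) x y xi : vna_set M x -> vna_set M y ->
  commutator (a \*: x \+ y) xi = a *: commutator x xi + commutator y xi.
Proof.
move=> Mx My; have Mi := star_id Ms.
rewrite /commutator /bimod tensor_opp_combl // tensor_opp_combr //.
rewrite !lmul_comb; try exact: vna_tensor_opp.
by rewrite scalerBr opprD addrACA.
Qed.

Lemma commutator_comp x y xi : vna_set M x -> vna_set M y ->
  commutator (x \o y) xi =
    bimod x (commutator y xi) idfun + bimod idfun (commutator x xi) y.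
Proof.
move=> Mx My; have Mi := star_id Ms.
rewrite /commutator (linB (bimod_lin Mx Mi)) (linB (bimod_lin Mi My)).
by rewrite !bimod_bimod // addrA subrK.
Qed.

(* Both sides are the product of the two commuting elements x (x) 1 - 1 (x) x^o
   and y (x) 1 - 1 (x) y^o. *)
Lemma commutatorC x y xi : vna_set M x -> vna_set M y -> x \o y = y \o x ->
  commutator x (commutator y xi) = commutator y (commutator x xi).
Proof.
move=> Mx My xy; have Mi := star_id Ms.
rewrite /commutator !(linB (bimod_lin Mx Mi)) !(linB (bimod_lin Mi Mx)).
rewrite !(linB (bimod_lin My Mi)) !(linB (bimod_lin Mi My)).
rewrite !bimod_bimod // xy !opprB addrACA [RHS]addrACA; congr (_ + _).
exact: addrC.
Qed.

(** Hermitian symmetry of the inner product of L2(M), at the classes of x and 1. *)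
Lemma trace_adj (LM : L2_space M) x : vna_set M x -> tau (adj x) = Num.conj (tau x).
Proof.
move=> Mx; have Mi := star_id Ms.
rewrite -[x in RHS](_ : adj idfun \o x = x) ?adj_idfun // -[in RHS]adj_idfun.
by rewrite -(hatP LM) // -hdotC hatP.
Qed.

(** The vector state of [one] is the product trace; the conjugation in the opposite trace cancels
    the adjoint in [tensor_opp]. *)
Lemma dot_bimod_one (LM : L2_space M) x y : vna_set M x -> vna_set M y ->
  '[bimod x one y, one] = tau x * tau y.
Proof.
move=> Mx My; have My' := star_adj Ms My; have Wxy := vna_tensor_opp Mx My.
rewrite /bimod lmul_hat //; last exact: star_id Ws.
rewrite hat_dot_id // tensor_trace //=; congr (_ * _).
by rewrite (trace_adj LM) // conjCK.
Qed.

End Bimodule.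

(** * Diffuse distributions *)

Section MeasurableComplex.
Context d (T : measurableType d) (R : realType).
Implicit Types (f g : T -> R[i]).

(** No bound is imposed, because the coordinate of the plane is unbounded and agrees with its
    truncation only almost everywhere. *)
Definition cmeas f := measurable_fun setT (fun t => complex.Re (f t)) /\
  measurable_fun setT (fun t => complex.Im (f t)).

Lemma cmeasM f g : cmeas f -> cmeas g -> cmeas (fun t => f t * g t).
Proof.
move=> [f1 f2] [g1 g2]; split.
  under eq_fun do rewrite cReM.
  by apply: measurable_funB; exact: measurable_funM.
under eq_fun do rewrite cImM.
by apply: measurable_funD; exact: measurable_funM.
Qed.

Lemma cmeasX f k : cmeas f -> cmeas (fun t => f t ^+ k).
Proof.
move=> mf; elim: k => [|k IHk]; first by split; exact: measurable_cst.
by under eq_fun do rewrite exprS; exact: cmeasM.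
Qed.

Lemma cmeas_conj f : cmeas f -> cmeas (fun t => Num.conj (f t)).
Proof.
have ReC (z : R[i]) : complex.Re (Num.conj z) = complex.Re z by case: z.
have ImC (z : R[i]) : complex.Im (Num.conj z) = - complex.Im z by case: z.
move=> [f1 f2]; split; first by under eq_fun do rewrite ReC.
by under eq_fun do rewrite ImC; exact: measurable_funN.
Qed.

Lemma cbdd_cmeas f : cbdd_meas f -> cmeas f.
Proof. by move=> [[? _] [? _]]. Qed.

Lemma cexpect_ae_eq (P : probability T R) f g (Q : set T) : measurable Q ->
  P (~` Q) = 0%E -> cmeas f -> cmeas g -> (forall t, Q t -> f t = g t) ->
  cexpect P f = cexpect P g.
Proof.
move=> mQ PQ [f1 f2] [g1 g2] fg.
have h (F G : T -> R) : measurable_fun setT F -> measurable_fun setT G ->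
    (forall t, Q t -> F t = G t) -> \int[P]_t F t = \int[P]_t G t.
  move=> mF mG FG; congr fine; apply: ae_eq_integral => //.
  - exact/measurable_EFinP.
  - exact/measurable_EFinP.
  - exists (~` Q); split => //; first exact: measurableC.
    by move=> t /= FGt Qt; apply: FGt => _; rewrite FG.
rewrite /cexpect; congr (_ +i* _); apply: h => // t Qt; by rewrite fg.
Qed.

End MeasurableComplex.

Section TruncatedCoordinate.
Variables (R : realType) (r : R).
Local Notation T := (measurableTypeR R * measurableTypeR R)%type.

Definition square : set T := `[- r, r] `*` `[- r, r].

(** The spectral distribution is carried by a square; cutting the coordinate off outside it gives a
    bounded function with the same moments. *)
Definition trunc (s : T) : R[i] :=
  (s.1 * \1_square s) +i* (s.2 * \1_square s).

Lemma measurable_square : measurable square.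
Proof. by apply: measurableX; exact: measurable_itv. Qed.

Lemma truncE s : square s -> trunc s = s.1 +i* s.2.
Proof. by move=> sQ; rewrite /trunc indicE mem_set //= !mulr1. Qed.

Lemma trunc_le s : `|complex.Re (trunc s)| <= `|r| /\ `|complex.Im (trunc s)| <= `|r|.
Proof.
rewrite /trunc /= indicE; case: (boolP (s \in square)) => [|_]; last first.
  by rewrite /= !mulr0 normr0.
have h (a : R) : `[- r, r]%classic a -> `|a| <= `|r|.
  rewrite /= in_itv /= => /andP[ar ra].
  by apply: le_trans (ler_norm r); rewrite ler_norml ar ra.
by rewrite inE => -[/h ? /h ?]; rewrite !mulr1.
Qed.

Lemma cbdd_trunc : cbdd_meas trunc.
Proof.
split; split.
- by apply: measurable_funM; [exact: measurable_fst|
    apply: measurable_indic; exact: measurable_square].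
- by exists `|r| => s; have [] := trunc_le s.
- by apply: measurable_funM; [exact: measurable_snd|
    apply: measurable_indic; exact: measurable_square].
- by exists `|r| => s; have [] := trunc_le s.
Qed.

Lemma cmeas_coord : cmeas (fun s : T => s.1 +i* s.2).
Proof. by split; [exact: measurable_fst|exact: measurable_snd]. Qed.

Variable mu : probability T R.
Hypotheses (mu_square : mu square = 1%E) (mu_diffuse : forall s, mu [set s] = 0%E).

Lemma mu_squareC : mu (~` square) = 0%E.
Proof.
by rewrite probability_setC ?mu_square ?subee //; exact: measurable_square.
Qed.

(** The whole complement of the square is sent to 0, so a fibre lies in the union of that null set
    and a single point. *)
Lemma trunc_fiber0 (w : R[i]) : mu [set s | trunc s = w] = 0%E.
Proof.
have [[mR _] [mI _]] := cbdd_trunc.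
have mF : measurable [set s | trunc s = w].
  rewrite (_ : [set s | trunc s = w] =
    (setT `&` (fun s => complex.Re (trunc s)) @^-1` [set complex.Re w]) `&`
    (setT `&` (fun s => complex.Im (trunc s)) @^-1` [set complex.Im w])).
    by apply: measurableI; [apply: mR|apply: mI] => //; exact: measurable_set1.
  apply/seteqP; split => s /=; first by move=> <-.
  move=> [[_ h1] [_ h2]].
  by case: (w) h1 h2 => a b /= <- <-.
pose p : T := (complex.Re w, complex.Im w).
have mp : measurable [set p].
  rewrite (_ : [set p] = [set p.1] `*` [set p.2]).
    by apply: measurableX; exact: measurable_set1.
  by apply/seteqP; split => [s -> //|[a b] /= [-> ->]].
have mU : measurable (~` square `|` [set p]).
  by apply: measurableU => //; apply: measurableC; exact: measurable_square.
apply: (@subset_measure0 _ T R mu _ (~` square `|` [set p])) => //.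
  move=> s /= sw; have [sQ|] := pselect (square s); last by left.
  right; rewrite /p -sw truncE //=; by case: s {sw sQ}.
apply: null_set_setU => //; [|exact: mu_squareC|exact: mu_diffuse].
by apply: measurableC; exact: measurable_square.
Qed.

End TruncatedCoordinate.

(** * Mass of the diagonal under a product measure *)

Section Proximity.
Context d (T : measurableType d) (R : realType).
Variables (mu : probability T R) (f : T -> R[i]) (r : R).
Hypotheses (bf : cbdd_meas f)
  (f_le : forall s, `|complex.Re (f s)| <= r /\ `|complex.Im (f s)| <= r)
  (f_fiber0 : forall w, mu [set s | f s = w] = 0%E).

(** The function that represents 1 - [D_z^* D_z]/c; for c > 0 it equals 1 exactly where the two
    values of f agree. *)
Definition proximity (c : R) (p : T * T) : R :=
  1 - c^-1 * ((complex.Re (f p.1) - complex.Re (f p.2)) ^+ 2 +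
              (complex.Im (f p.1) - complex.Im (f p.2)) ^+ 2).

Lemma bdd_proximity c : bdd_meas (proximity c).
Proof.
have [bR bI] := bf.
apply: bdd_measB; first exact: bdd_meas_cst.
apply: bdd_measM; first exact: bdd_meas_cst.
apply: bdd_measD; apply: bdd_measX; apply: bdd_measB;
  [exact (@bdd_meas_fst _ _ T T R _ bR)|exact (@bdd_meas_snd _ _ T T R _ bR)|
   exact (@bdd_meas_fst _ _ T T R _ bI)|exact (@bdd_meas_snd _ _ T T R _ bI)].
Qed.

Lemma proximityE c p : (proximity c p)%:C = 1 - c^-1%:C *
  ((f p.1 - f p.2) * Num.conj (f p.1 - f p.2)).
Proof.
rewrite /proximity; case: (f p.1) => a b; case: (f p.2) => a' b'.
by apply/eqP; rewrite eq_complex /=; apply/andP; split; apply/eqP; ring.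
Qed.

(** Real and imaginary parts differ by at most 2r, so 8 r^2 bounds the squared distance of two
    values and the function stays in [0, 1]. *)
Lemma proximity_cvg0 c : 0 < c -> 8 * r ^+ 2 <= c ->
  (\int[(mu \x mu)%E]_p (proximity c p ^+ k)) @[k --> \oo] --> (0 : R).
Proof.
move=> c0 rc; apply: Rintegral_powers_cvg0; first exact: bdd_proximity.
  move=> p; rewrite /proximity.
  have [a1 b1] := f_le p.1; have [a2 b2] := f_le p.2.
  have h (x y : R) : `|x| <= r -> `|y| <= r -> 0 <= (x - y) ^+ 2 <= 4 * r ^+ 2.
    move=> xr yr; rewrite sqr_ge0 /=.
    have : `|x - y| <= 2 * r.
      by rewrite (le_trans (ler_normB _ _)) // mulr_natl mulr2n lerD.
    have r0 : 0 <= r := le_trans (normr_ge0 x) xr.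
    rewrite -(@ler_pXn2r _ 2) ?nnegrE ?mulr_ge0 // exprMn.
    by rewrite real_normK ?num_real // -natrX.
  have /andP[x0 x1] := h _ _ a1 a2; have /andP[y0 y1] := h _ _ b1 b2.
  move: x0 x1 y0 y1; set x := (complex.Re _ - _) ^+ 2.
  set y := (complex.Im _ - _) ^+ 2 => x0 x1 y0 y1.
  rewrite subr_ge0 ler_pdivrMl // mulr1 gerBl mulr_ge0 ?addr_ge0 ?invr_ge0 ?(ltW c0) //.
  by rewrite andbT; apply: le_trans rc; lra.
(* The product measure of the set where the function is 1 is the integral of the measures of its
   sections, and these are fibres of f. *)
rewrite [LHS]integral0_eq // => s _.
rewrite /= (_ : xsection _ _ = [set t | f t = f s]); first exact: f_fiber0.
rewrite xsectionE; apply/seteqP; split => t /=; rewrite /proximity /=.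
  move=> /eqP; rewrite subr_eq addrC -subr_eq subrr eq_sym mulf_eq0 invr_eq0 gt_eqF //=.
  rewrite paddr_eq0 ?sqr_ge0 // !sqrf_eq0 !subr_eq0.
  by case: (f s) => a b; case: (f t) => a' b' /= /andP[/eqP -> /eqP ->].
by move=> ->; rewrite !subrr expr0n /= addr0 mulr0 subr0.
Qed.

End Proximity.

Section DiffuseModel.
Variables (R : realType) (M : tracial_vna R) (z : op M).

Definition moment_model d (T : measurableType d) (mu : probability T R)
    (f : T -> R[i]) (r : R) :=
  [/\ cbdd_meas f,
      forall s, `|complex.Re (f s)| <= r /\ `|complex.Im (f s)| <= r,
      forall w, mu [set s | f s = w] = 0%E &
      forall m k, vna_trace M (iter m z \o iter k (adj z)) =
        cexpect mu (fun s => f s ^+ m * Num.conj (f s) ^+ k)].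

Lemma diffuse_moment_model : diffuse z ->
  exists d (T : measurableType d) (mu : probability T R) f r,
    moment_model mu f r.
Proof.
move=> [_ [mu [[[r mur] mom] mu0]]].
exists _, (measurableTypeR R * measurableTypeR R)%type, mu, (trunc r), `|r|.
split; [exact: cbdd_trunc|exact: trunc_le|exact: trunc_fiber0|move=> m k].
rewrite mom; apply: (cexpect_ae_eq (measurable_square r)).
- exact: mu_squareC.
- by apply: cmeasM; apply: cmeasX; [|apply: cmeas_conj]; exact: cmeas_coord.
- apply: cbdd_cmeas; apply: cbdd_measM; apply: cbdd_measX;
    [|apply: cbdd_meas_conj]; exact: cbdd_trunc.
- by move=> s sQ; rewrite truncE.
Qed.

End DiffuseModel.

(** * Injectivity of the commutator with a diffuse normal element *)

Section DiffuseKernel.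
Variables (R : realType) (M : tracial_vna R).
Variables (W : tensor_vna M (opposite_vna M)) (LW : L2_space W).
Variables (LM : L2_space M) (z : op M).
Hypotheses (Mz : vna_set M z) (zN : z \o adj z = adj z \o z).
Variables (d : measure_display) (T : measurableType d) (mu : probability T R).
Variables (f : T -> R[i]) (r : R).
Hypothesis zf : moment_model z mu f r.
Let Ms := vna_star M.
Let Ws := vna_star W.
Let Mz' := star_adj Ms Mz.
Local Notation one := (hat LW idfun).
Local Notation P := (mu \x mu)%E.

Let word a b : op M := iter a z \o iter b (adj z).

Let vna_word a b : vna_set M (word a b).
Proof. by apply: (star_comp Ms); exact: (star_iter Ms). Qed.

Let weight a b (s : T) : R[i] := f s ^+ a * Num.conj (f s) ^+ b.

(** Normality makes every one-sided product of a word with z or its adjoint a word again, with one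
    exponent raised. *)
Let word_zr a b : word a b \o z = word a.+1 b.
Proof.
apply/funext => u; rewrite /word /= -iterS iterSr; congr (iter a z _).
elim: b => //= b ->; have := congr1 (@^~ (iter b (adj z) u)) zN; exact: esym.
Qed.

Let word_zl a b : z \o word a b = word a.+1 b.
Proof. by []. Qed.

Let word_adjr a b : word a b \o adj z = word a b.+1.
Proof. by apply/funext => u; rewrite /word /= -iterS iterSr. Qed.

Let word_adjl a b : adj z \o word a b = word a b.+1.
Proof.
apply/funext => u; rewrite /word /=; elim: a => //= a <-.
by have := congr1 (@^~ (iter a z (iter b (adj z) u))) zN; exact: esym.
Qed.

(* The *-moments of v against 1 under the commuting normal operators z (x) 1 and
   1 (x) z^o are those of F under the coordinates of mu x mu. *)
Definition represents (v : LW) (F : T * T -> R[i]) :=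
  cbdd_meas F /\ forall a b c e,
    '[bimod (word a b) v (word c e), one] =
    cexpect P (fun p => F p * (weight a b p.1 * weight c e p.2)).

Let cbdd_weight a b c e :
  cbdd_meas (fun p : T * T => weight a b p.1 * weight c e p.2).
Proof.
have [bf _ _ _] := zf.
have h a' b' : cbdd_meas (weight a' b').
  by apply: cbdd_measM; apply: cbdd_measX => //; exact: cbdd_meas_conj.
by apply: cbdd_measM; [exact (@cbdd_meas_fst _ _ T T R _ (h a b))|
  exact (@cbdd_meas_snd _ _ T T R _ (h c e))].
Qed.

Let cbdd_coord1 : cbdd_meas (fun p : T * T => f p.1).
Proof. by have [bf _ _ _] := zf; exact (@cbdd_meas_fst _ _ T T R _ bf). Qed.

Let cbdd_coord2 : cbdd_meas (fun p : T * T => f p.2).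
Proof. by have [bf _ _ _] := zf; exact (@cbdd_meas_snd _ _ T T R _ bf). Qed.

Lemma represents_one : represents one (fun=> 1).
Proof.
split=> [|a b c e]; first exact: cbdd_meas_cst.
have [bf _ _ mom] := zf.
rewrite (dot_bimod_one _ LM) // !mom -cexpect_prod; last 2 first.
- by apply: cbdd_measM; apply: cbdd_measX => //; exact: cbdd_meas_conj.
- by apply: cbdd_measM; apply: cbdd_measX => //; exact: cbdd_meas_conj.
by congr cexpect; apply/funext => p; rewrite mul1r.
Qed.

Lemma represents_comb (a : R[i]) v w F G : represents v F -> represents w G ->
  represents (a *: v + w) (fun p => a * F p + G p).
Proof.
move=> [bF vF] [bG wG]; split=> [|m k c e].
  by apply: cbdd_measD bG; apply: cbdd_measM bF; exact: cbdd_meas_cst.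
rewrite (bimod_lin (vna_word m k) (vna_word c e)) linearPl /= vF wG.
rewrite -cexpect_comb; [|exact: cbdd_measM|exact: cbdd_measM].
by congr cexpect; apply/funext => p; rewrite mulrDl mulrA.
Qed.

Let Mi := star_id Ms.

Lemma represents_left v F : represents v F ->
  represents (bimod z v idfun) (fun p => F p * f p.1).
Proof.
move=> [bF vF]; split=> [|a b c e]; first exact: cbdd_measM.
rewrite bimod_bimod // word_zr (vF a.+1 b c e).
by congr cexpect; apply/funext => p; rewrite /weight exprS; ring.
Qed.

Lemma represents_left_adj v F : represents v F ->
  represents (bimod (adj z) v idfun) (fun p => F p * Num.conj (f p.1)).
Proof.
move=> [bF vF]; split=> [|a b c e].
  by apply: cbdd_measM => //; exact: cbdd_meas_conj.
rewrite bimod_bimod // word_adjr (vF a b.+1 c e).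
by congr cexpect; apply/funext => p; rewrite /weight exprS; ring.
Qed.

Lemma represents_right v F : represents v F ->
  represents (bimod idfun v z) (fun p => F p * f p.2).
Proof.
move=> [bF vF]; split=> [|a b c e]; first exact: cbdd_measM.
rewrite bimod_bimod // word_zl (vF a b c.+1 e).
by congr cexpect; apply/funext => p; rewrite /weight exprS; ring.
Qed.

Lemma represents_right_adj v F : represents v F ->
  represents (bimod idfun v (adj z)) (fun p => F p * Num.conj (f p.2)).
Proof.
move=> [bF vF]; split=> [|a b c e].
  by apply: cbdd_measM => //; exact: cbdd_meas_conj.
rewrite bimod_bimod // word_adjl (vF a b c e.+1).
by congr cexpect; apply/funext => p; rewrite /weight exprS; ring.
Qed.

Lemma represents_ext v F G : represents v F -> F =1 G -> represents v G.
Proof. by move=> vF /funext <-. Qed.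

Lemma represents_commutator v F : represents v F ->
  represents (commutator z v) (fun p => F p * (f p.1 - f p.2)).
Proof.
move=> vF; rewrite /commutator addrC -scaleN1r.
apply: represents_ext (represents_comb (-1) (represents_right vF) (represents_left vF)) _.
by move=> p; ring.
Qed.

Lemma represents_commutator_adj v F : represents v F ->
  represents (commutator (adj z) v) (fun p => F p * Num.conj (f p.1 - f p.2)).
Proof.
move=> vF; rewrite /commutator addrC -scaleN1r.
apply: represents_ext (represents_comb (-1) (represents_right_adj vF)
  (represents_left_adj vF)) _.
by move=> p; rewrite rmorphB; ring.
Qed.

Variable c : R.
Local Notation res := (residual (commutator (adj z)) (commutator z : LW -> LW) c).

Lemma represents_residual v F : represents v F ->
  represents (res v) (fun p => F p * (proximity f c p)%:C).
Proof.
move=> vF; rewrite /residual addrC -scaleNr.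
apply: represents_ext (represents_comb (- c^-1%:C)
  (represents_commutator_adj (represents_commutator vF)) vF) _.
by move=> p; rewrite proximityE; ring.
Qed.

Lemma represents_residual_iter k :
  represents (iter k res one) (fun p => (proximity f c p ^+ k)%:C).
Proof.
elim: k => [|k IHk]; first exact: represents_one.
apply: represents_ext (represents_residual IHk) _ => p.
by rewrite exprS rmorphM mulrC.
Qed.

Lemma residual_iter_moment k :
  rdot (iter k res one) one = \int[P]_p (proximity f c p ^+ k).
Proof.
have [_ /(_ 0 0 0 0)%N] := represents_residual_iter k.
rewrite /rdot /word /= => E.
have -> : iter k res one = bimod (idfun \o idfun) (iter k res one) (idfun \o idfun).
  by rewrite -[LHS]bimod_id.
rewrite E /cexpect /=; apply: eq_Rintegral => p _.
by ring.
Qed.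

Hypothesis c_gt0 : 0 < c.
Let adj_pair : adjoint_pair (commutator (adj z)) (commutator z : LW -> LW) :=
  adjoint_pair_sym (commutator_adjoint Mz).

Let residual_op : op W :=
  (- c^-1%:C) \*: (@commutator_op R M W (adj z) \o @commutator_op R M W z) \+ idfun.

Let vna_residual_op : vna_set W residual_op.
Proof.
apply: (star_comb Ws); last exact: star_id Ws.
by apply: (star_comp Ws); exact: vna_commutator.
Qed.

(** The iterates act by left multiplication, hence commute with right multiplication by x; this
    carries estimates at 1 over to the class of x. *)
Lemma residual_iter_hat k x : vna_set W x ->
  iter k res (hat LW x) = hat LW (iter k residual_op \o x).
Proof.
move=> Wx; elim: k => [|k IHk] //=.
have Wk := star_comp Ws (star_iter Ws k vna_residual_op) Wx.
rewrite IHk -[RHS](lmul_hat LW vna_residual_op Wk) /residual.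
rewrite lmul_comb; [|by apply: (star_comp Ws); exact: vna_commutator|exact: star_id Ws].
rewrite lmul_id lmul_comp; try exact: vna_commutator.
by rewrite -!commutatorE // addrC scaleNr.
Qed.

Hypothesis c_ge : 8 * r ^+ 2 <= c.
Hypothesis c_bound : forall u : LW,
  rdot (commutator (adj z) u) (commutator (adj z) u) <= c * rdot u u.

Let residual_fixed k (u : LW) : commutator z u = 0 -> iter k res u = u.
Proof.
move=> u0; elim: k => //= k ->; rewrite /residual u0.
by rewrite (lin0 (commutator_lin Mz')) scaler0 subr0.
Qed.

(** The limit w is orthogonal to 1 by the moment integrals. Since w is fixed by the self-adjoint
    residual, [<B^k 1, w> = <1, w> = 0] for every k, and the limit in k is [|w|^2]. *)
Lemma residual_one_cvg0 : hcvg (fun k => iter k res one) 0.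
Proof.
have [w ow w0] := residual_cvg adj_pair c_gt0 c_bound one.
have [bf f_le f0 _] := zf.
have w1 : rdot w one = 0.
  apply: cvg_unique (hcvg_rdot (v := one) ow) _; first exact: norm_hausdorff.
  have -> : (fun k => rdot (iter k res one) one) =
      (fun k => \int[P]_p (proximity f c p ^+ k)).
    by apply/funext => k; exact: residual_iter_moment.
  exact: (@proximity_cvg0 _ _ _ mu f r).
suff <- : w = 0 by [].
apply: hnorm_eq0; apply/eqP; rewrite -sqrf_eq0 hnorm_sq; apply/eqP.
apply: cvg_const_eq (hcvg_rdot (v := w) ow) _ => k.
rewrite -(add0n k) -(residual_iter_dot c adj_pair 0 k) /= residual_fixed //.
by rewrite rdotC.
Qed.

(** A kernel vector u is fixed by the residual, so its inner product with the iterates of [hat LW x]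
    is constant; these iterates tend to 0 because right multiplication by x is bounded. Thus u is
    orthogonal to a dense subspace. *)
Lemma commutator_ker (u : LW) : commutator z u = 0 -> u = 0.
Proof.
move=> u0; have ux x : vna_set W x -> rdot (hat LW x) u = 0.
  move=> Wx; have [C C0 xC] := hat_comp_le LW Wx.
  have x0 : hcvg (fun k => iter k res (hat LW x)) 0.
    apply: (@squeeze0 _ _ (fun k => C * hnorm (iter k res one - 0))).
      move=> k; rewrite hnorm_ge0 !subr0 !residual_iter_hat //; last exact: star_id Ws.
      exact: xC (star_iter Ws k vna_residual_op).
    rewrite -[X in _ --> X](mulr0 C); apply: cvgM; first exact: cvg_cst.
    exact: residual_one_cvg0.
  have e : rdot (0 : LW) u = rdot (hat LW x) u.
    apply: cvg_const_eq (hcvg_rdot (v := u) x0) _ => k.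
    by rewrite -(add0n k) -(residual_iter_dot c adj_pair 0 k) /= residual_fixed.
  by rewrite -e /rdot linear0l.
apply: hnorm_eq0; apply/eqP; rewrite -sqrf_eq0 hnorm_sq; apply/eqP.
have [x Wx xu] := hat_approx u.
by apply: cvg_const_eq (hcvg_rdot (v := u) xu) _ => k; exact: ux.
Qed.

End DiffuseKernel.

Lemma diffuse_commutator_ker (R : realType) (M : tracial_vna R)
    (W : tensor_vna M (opposite_vna M)) (LW : L2_space W) (LM : L2_space M)
    (z : op M) (u : LW) :
  vna_set M z -> diffuse z -> commutator z u = 0 -> u = 0.
Proof.
move=> Mz zd; have [zN _] := zd.
have [d [T [mu [f [r zf]]]]] := diffuse_moment_model zd.
have [b b0 zb] := commutator_bounded LW (star_adj (vna_star M) Mz).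
(* In c, the term b^2 dominates the commutator, 8 r^2 keeps [proximity] in [0, 1], and 1 ensures
   positivity. *)
have c0 : 0 < b ^+ 2 + 8 * r ^+ 2 + 1.
  by have := sqr_ge0 b; have := sqr_ge0 r; lra.
apply: (commutator_ker LM Mz zN zf c0).
  by have := sqr_ge0 b; lra.
move=> v; rewrite -!hnorm_sq; apply: (@le_trans _ _ (b ^+ 2 * hnorm v ^+ 2)).
  by rewrite -exprMn ler_pXn2r ?nnegrE ?mulr_ge0 ?hnorm_ge0 // ltW.
by rewrite ler_wpM2r ?sqr_ge0 //; have := sqr_ge0 r; lra.
Qed.

(** * Inner derivations *)

Section InnerDerivations.
Variables (R : realType) (M : tracial_vna R).
Variables (W : tensor_vna M (opposite_vna M)) (LW : L2_space W).
Variables (LM : L2_space M) (A : set (op M)).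
Hypotheses (As : star_subalgebra A) (AM : A `<=` vna_set M).
Local Notation one := (hat LW idfun).
Local Notation tau := (vna_trace M).
Let Ms := vna_star M.
Let Ws := vna_star W.
Let Ai := star_id As.

(* The image of A (x) A^o in L2(W). *)
Inductive tensor_span : LW -> Prop :=
| tensor_span0 : tensor_span 0
| tensor_span_cons x y xi : A x -> A y -> tensor_span xi ->
    tensor_span (bimod x one y + xi).

Lemma tensor_span_bimod1 x y : A x -> A y -> tensor_span (bimod x one y).
Proof.
by move=> Ax Ay; rewrite -[bimod _ _ _]addr0; apply: tensor_span_cons => //;
  exact: tensor_span0.
Qed.

Lemma tensor_span_one : tensor_span one.
Proof. by rewrite -[one]bimod_id; exact: tensor_span_bimod1. Qed.

Lemma tensor_spanD xi eta : tensor_span xi -> tensor_span eta ->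
  tensor_span (xi + eta).
Proof.
move=> + teta; elim => [|x y zeta Ax Ay _ IH]; first by rewrite add0r.
by rewrite -addrA; exact: tensor_span_cons.
Qed.

Lemma tensor_spanZ (a : R[i]) xi : tensor_span xi -> tensor_span (a *: xi).
Proof.
elim => [|x y zeta Ax Ay _ IH]; first by rewrite scaler0; exact: tensor_span0.
rewrite scalerDr; apply: tensor_spanD => //.
rewrite -bimod_scalel; [|exact: AM|exact: AM].
by apply: tensor_span_bimod1 => //; exact: (star_scale As).
Qed.

Lemma tensor_spanB xi eta : tensor_span xi -> tensor_span eta ->
  tensor_span (xi - eta).
Proof.
by move=> txi teta; rewrite -scaleN1r; apply: tensor_spanD => //; exact: tensor_spanZ.
Qed.

Lemma tensor_span_sum I (r : seq I) (P : pred I) (F : I -> LW) :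
  (forall i, P i -> tensor_span (F i)) -> tensor_span (\sum_(i <- r | P i) F i).
Proof.
move=> tF; elim/big_ind: _ => //; [exact: tensor_span0|exact: tensor_spanD].
Qed.

Lemma tensor_span_bimod x y xi : A x -> A y -> tensor_span xi ->
  tensor_span (bimod x xi y).
Proof.
move=> Ax Ay; have bl := bimod_lin (LW := LW) (AM Ax) (AM Ay).
elim=> [|x' y' zeta Ax' Ay' _ IH]; first by rewrite (lin0 bl); exact: tensor_span0.
rewrite (linD bl) (bimod_bimod _ (AM Ax) (AM Ax') (AM Ay) (AM Ay')).
by apply: tensor_span_cons => //; exact: (star_comp As).
Qed.

Lemma tensor_span_commutator x xi : A x -> tensor_span xi ->
  tensor_span (commutator x xi).
Proof. by move=> Ax txi; apply: tensor_spanB; exact: tensor_span_bimod. Qed.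

Lemma tensor_span_alg xi : tensor_span xi ->
  exists2 a, @alg_tensor R M W A a & xi = hat LW a.
Proof.
elim=> [|x y zeta Ax Ay _ [a [n [xs [ys [Axs Ays ->]]]] ->]].
  exists (fun=> 0); last by rewrite hat_zero.
  exists 0%N, (fun=> idfun), (fun=> idfun); split; [by case|by case|].
  by apply/funext => w; rewrite big_ord0.
pose xs' (i : 'I_n.+1) := if unlift ord0 i is Some j then xs j else x.
pose ys' (i : 'I_n.+1) := if unlift ord0 i is Some j then ys j else y.
have Wxy := vna_tensor_opp W (AM Ax) (AM Ay).
exists (tensor_opp x y \+ (fun w => \sum_(i < n) tensor_opp (xs i) (ys i) w)).
  exists n.+1, xs', ys'; split.
  - by move=> i; rewrite /xs'; case: unlift.
  - by move=> i; rewrite /ys'; case: unlift.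
  apply/funext => w; rewrite big_ord_recl /xs' /ys' unlift_none /=.
  by congr (_ + _); apply: eq_bigr => i _; rewrite liftK.
rewrite hat_add //; last first.
  by apply: (star_sum Ws) => i _; apply: vna_tensor_opp; apply: AM.
by congr (_ + _); rewrite /bimod lmul_hat //; exact: star_id Ws.
Qed.

Lemma tensor_span_closure xi : tensor_span xi ->
  L2_closure LW (@alg_tensor R M W A) xi.
Proof.
move=> /tensor_span_alg[a Aa ->] e e0; exists a => //.
by rewrite subrr hnorm0.
Qed.

Lemma L2_closure_hcvg (S : set (op W)) (u : nat -> LW) xi :
  (forall k, L2_closure LW S (u k)) -> hcvg u xi -> L2_closure LW S xi.
Proof.
move=> Su /hcvgP uxi e e0; have e2 : 0 < e / 2 by rewrite divr_gt0.
have [N Nh] := uxi _ e2; have [a Sa ua] := Su N _ e2.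
exists a => //; rewrite -(subrK (u N) xi) -addrA (le_lt_trans (hnorm_triangle _ _)) //.
by rewrite (splitr e) ltrD // hnorm_sub Nh.
Qed.

Lemma derivation_commutator xi : tensor_span xi ->
  derivation A (fun x => commutator x xi).
Proof.
move=> txi; split.
- by move=> x Ax; apply: tensor_span_closure; exact: tensor_span_commutator.
- by move=> a x y Ax Ay; apply: commutator_comb; exact: AM.
- by move=> x y Ax Ay; apply: commutator_comp; exact: AM.
Qed.

Lemma commutator_dot_one xi : tensor_span xi -> exists2 w, A w &
  forall x, A x -> '[commutator x xi, one] = '[hat LM x, hat LM w].
Proof.
elim=> [|x y zeta Ax Ay _ [w Aw wP]].
  exists (fun=> 0); first exact: star_zero As.
  move=> x Ax; rewrite (lin0 (commutator_lin (AM Ax))) hat_zero.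
  by rewrite linear0l linear0r.
have Ax' := star_adj As Ax; have Ay' := star_adj As Ay.
(* For x (x) y^o the inner product of its commutator with t against 1 is tau(t x) tau(y) - tau(x)
   tau(y t). By traciality this is linear in [hat LM t] with this representing vector. *)
exists (Num.conj (tau y) \*: adj x \+ ((- Num.conj (tau x)) \*: adj y \+ w)).
  by apply: (star_comb As) => //; exact: (star_comb As).
move=> t At; rewrite (linD (commutator_lin (AM At))) linearDl /= wP //.
have Mt := AM At; have Mx := AM Ax; have My := AM Ay.
have Mx' := AM Ax'; have My' := AM Ay'.
rewrite (hat_linear LM _ Mx' (AM (star_comb As _ Ay' Aw))) (hat_linear LM _ My' (AM Aw)).
rewrite !linearPr /= rmorphN /= !conjCK addrA; congr (_ + _).
have Mi := star_id Ms.
rewrite /commutator !bimod_bimod // linearBl /= !(dot_bimod_one _ LM) //;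
  try exact: (star_comp Ms).
rewrite !hatP // !(adjK Ms) // (traceC Mt Mx) (_ : y \o idfun = y) //.
by rewrite (_ : idfun \o x = x) // mulNr; congr (_ - _); rewrite mulrC.
Qed.

Lemma Der11_commutator xi : tensor_span xi ->
  Der11 LM A (fun x => commutator x xi).
Proof.
move=> txi; split; first exact: derivation_commutator.
have [w Aw wP] := commutator_dot_one txi; exists (hat LM w).
  by move=> e e0; exists w => //; rewrite subrr hnorm0.
move=> x Ax; rewrite -wP //; congr ('[_, hat LW _]).
exact: tensor_opp_id.
Qed.

End InnerDerivations.

(** * Gradients along the generators *)

Section Generators.
Variables (R : realType) (M : tracial_vna R).
Variables (W : tensor_vna M (opposite_vna M)) (LW : L2_space W).
Variables (LM : L2_space M) (A : set (op M)).
Hypotheses (As : star_subalgebra A) (AM : A `<=` vna_set M).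
Variables (n : nat) (X : 'I_n -> op M).
Hypothesis X_gen : selfadjoint_generators A X.
Local Notation one := (hat LW idfun).
Local Notation Hn := (hpow LW n).
Let Ms := vna_star M.
Let Ws := vna_star W.
Let Ai := star_id As.

Lemma generator_mem i : A (X i).
Proof.
case: X_gen => _ _ ->; move=> B _; apply; by exists i.
Qed.

Let MX i : vna_set M (X i).
Proof. exact/AM/generator_mem. Qed.

Let MX' i : vna_set M (adj (X i)).
Proof. exact: (star_adj Ms (MX i)). Qed.

(** The elements satisfying P together with their adjoints form a star subalgebra, which contains
    the generators because X is closed under adjoints. *)
Lemma generators_ind (P : op M -> Prop) :
  (forall i, P (X i)) -> P idfun ->
  (forall (a : R[i]) x y, A x -> A y -> P x -> P y -> P (a \*: x \+ y)) ->
  (forall x y, A x -> A y -> P x -> P y -> P (x \o y)) ->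
  forall x, A x -> P x.
Proof.
move=> PX P1 Pcomb Pcomp.
pose B := [set x | [/\ A x, P x & P (adj x)]].
have B_star : star_subalgebra B.
  split.
  - by move=> x [/(star_bounded As)].
  - by split => //; rewrite adj_idfun.
  - move=> a x y [Ax Px Px'] [Ay Py Py']; split.
    + exact: (star_comb As).
    + exact: Pcomb.
    + by rewrite (adj_comb As) //; apply: Pcomb => //; exact: (star_adj As).
  - move=> x y [Ax Px Px'] [Ay Py Py']; split.
    + exact: (star_comp As).
    + exact: Pcomp.
    + by rewrite (adj_comp As) //; apply: Pcomp => //; exact: (star_adj As).
  - move=> x [Ax Px Px']; exists (adj x); last exact: (adjP As).
    by split => //; [exact: (star_adj As)|rewrite (adjK As)].
have XB : range X `<=` B.
  move=> _ [i _ <-]; split; [exact: generator_mem|exact: PX|].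
  by case: X_gen => _ /(_ i)[j /adjE ->] _; exact: PX.
move=> x Ax; suff [] : B x by [].
by case: X_gen Ax => _ _ -> /(_ B); apply.
Qed.

Definition grad (xi : LW) : Hn := fun i => commutator (X i) xi.

Definition grad_adj (eta : Hn) : LW := \sum_(i < n) commutator (adj (X i)) (eta i).

Lemma grad_adjoint : adjoint_pair grad grad_adj.
Proof.
move=> u v; rewrite hpow_dotE /grad_adj linear_sumr.
by apply: eq_bigr => i _; exact: (commutator_adjoint (MX i)).
Qed.

Lemma grad_lin : linear grad.
Proof. exact: adjoint_pair_linear grad_adjoint. Qed.

Lemma grad_bounded : exists2 c : R, 0 < c &
  forall u, rdot (grad u) (grad u) <= c * rdot u u.
Proof.
have /choice[b bP] i : exists b, forall u : LW, hnorm (commutator (X i) u) <= b * hnorm u.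
  by have [b _ ?] := commutator_bounded LW (MX i); exists b.
exists (\sum_(i < n) b i ^+ 2 + 1).
  by rewrite ltr_wpDl // sumr_ge0 // => i _; exact: sqr_ge0.
move=> u; rewrite hpow_rdot mulrDl mul1r -[leLHS]addr0 lerD ?rdot_ge0 //.
rewrite mulr_suml; apply: ler_sum => i _; rewrite -!hnorm_sq -exprMn.
rewrite ler_pXn2r ?nnegrE ?hnorm_ge0 //; first exact: bP.
exact: le_trans (hnorm_ge0 _) (bP i u).
Qed.

(** By the Leibniz rule, control on the generators propagates to each element of A, with a constant
    depending on that element. Both the convergence of derivations and the injectivity of [grad]
    rest on this. *)
Lemma commutator_le_grad x : A x -> exists2 C : R, 0 <= C &
  forall u : LW, hnorm (commutator x u) <= C * hnorm (grad u).
Proof.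
move: x; apply: (generators_ind (P := fun x => exists2 C : R, 0 <= C &
  forall u : LW, hnorm (commutator x u) <= C * hnorm (grad u))) =>
  [i||a x y Ax Ay [C C0 xC] [D D0 yD]|x y Ax Ay [C C0 xC] [D D0 yD]].
- exists 1 => // u; rewrite mul1r; exact: (hnorm_le_hpow (grad u) i).
- by exists 0 => // u; rewrite /commutator subrr hnorm0 mul0r.
- set m := Num.sqrt (complex.Re a ^+ 2 + complex.Im a ^+ 2).
  exists (m * C + D); first by rewrite addr_ge0 ?mulr_ge0 ?sqrtr_ge0.
  move=> u; rewrite commutator_comb; [|exact: AM|exact: AM].
  rewrite (le_trans (hnorm_triangle _ _)) // mulrDl lerD //.
  by rewrite hnorm_scale -mulrA ler_wpM2l ?sqrtr_ge0.
- have Mi := star_id Ms; have Mx := AM Ax; have My := AM Ay.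
  have [b b0 bP] := bounded_op_gt0 (lmul_bounded LW (vna_tensor_opp W Mx Mi)).
  have [e e0 eP] := bounded_op_gt0 (lmul_bounded LW (vna_tensor_opp W Mi My)).
  exists (b * D + e * C); first by rewrite addr_ge0 ?mulr_ge0 // ltW.
  move=> u; rewrite commutator_comp // (le_trans (hnorm_triangle _ _)) // mulrDl lerD //.
    by rewrite (le_trans (bP _)) // -mulrA ler_wpM2l ?yD // ltW.
  by rewrite (le_trans (eP _)) // -mulrA ler_wpM2l ?xC // ltW.
Qed.

Lemma hcvg_hpow (u : nat -> Hn) (v : Hn) i :
  hcvg u v -> hcvg (fun k => u k i) (v i).
Proof.
apply: squeeze0 => k; rewrite hnorm_ge0 /=.
exact: (hnorm_le_hpow (u k - v) i).
Qed.

(** A limit of gradients prescribes values on the generators only. The previous bound makes the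
    commutators converge at every element of A, and their pointwise limit inherits linearity and the
    Leibniz rule. *)
Lemma closure_Der11_limit (u : nat -> LW) (kappa : Hn) :
  (forall k, tensor_span A (u k)) -> hcvg (fun k => grad (u k)) kappa ->
  exists2 delta : op M -> LW, closure_Der11 LM A X delta & phi X delta = kappa.
Proof.
move=> tu uk.
have lim x : A x -> exists l, hcvg (fun k => commutator x (u k)) l.
  move=> Ax; have [C C0 xC] := commutator_le_grad Ax.
  apply: hcvg_cauchy => e e0.
  (* The divisor is C + 1, since C may be 0. *)
  have [N Nh] := hcvg_is_cauchy uk (divr_gt0 e0 (ltr_wpDl C0 ltr01)).
  exists N => m k Nm Nk; have := Nh m k Nm Nk.
  rewrite ltr_pdivlMr ?ltr_wpDl // -(linB grad_lin) -(linB (commutator_lin (AM Ax))).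
  apply: le_lt_trans; apply: le_trans (xC _) _.
  by rewrite mulrC ler_wpM2l ?hnorm_ge0 // lerDl.
pose delta x : LW := xget 0 [set l | hcvg (fun k => commutator x (u k)) l].
have deltaP x : A x -> hcvg (fun k => commutator x (u k)) (delta x).
  by move=> /lim[l ul]; exact: (xgetPex 0 (ex_intro _ l ul)).
have delta_phi : phi X delta = kappa.
  apply/funext => i.
  exact: hcvg_unique (deltaP _ (generator_mem i)) (hcvg_hpow i uk).
exists delta => //; split; first split.
- move=> x Ax; apply: L2_closure_hcvg (deltaP x Ax) => k.
  by apply: (tensor_span_closure As AM); exact: (tensor_span_commutator As AM).
- move=> a x y Ax Ay; apply: hcvg_unique (deltaP _ (star_comb As a Ax Ay)) _.
  apply: hcvg_ext (hcvgD (hcvgZ a (deltaP x Ax)) (deltaP y Ay)) _ => k.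
  by rewrite commutator_comb //; exact: AM.
- move=> x y Ax Ay; have Mi := star_id Ms; have Mx := AM Ax; have My := AM Ay.
  apply: hcvg_unique (deltaP _ (star_comp As Ax Ay)) _.
  apply: hcvg_ext (hcvgD (hcvg_bimod Mx Mi (deltaP y Ay))
    (hcvg_bimod Mi My (deltaP x Ax))) _ => k.
  by rewrite commutator_comp.
- move=> e e0; have /hcvgP/(_ e e0)[N Nh] := uk.
  exists (fun x => commutator x (u N)); first exact: (Der11_commutator LM As AM).
  have := Nh N (leqnn N); rewrite hnorm_sub hpow_hnorm -delta_phi.
  exact: id.
Qed.

Variable z : op M.
Hypotheses (z_center : in_center A z) (z_diffuse : diffuse z).
Let Az : A z := z_center.1.
Let Mz : vna_set M z := AM Az.

Lemma grad_ker (u : LW) : grad u = 0 -> u = 0.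
Proof.
move=> u0; apply: (diffuse_commutator_ker LM Mz z_diffuse).
have [C _ zC] := commutator_le_grad Az.
apply: hnorm_eq0; apply/eqP; rewrite eq_le hnorm_ge0 andbT.
by rewrite (le_trans (zC u)) // u0 hnorm0 mulr0.
Qed.

(** Compare the Leibniz expansions of delta at z x and at x z. *)
Lemma derivation_center (delta : op M -> LW) x : derivation A delta -> A x ->
  commutator z (delta x) = commutator x (delta z).
Proof.
move=> [_ _ dM] Ax; have := dM z x Az Ax; rewrite (z_center.2 x Ax) dM // => h.
rewrite /commutator; apply/eqP; rewrite subr_eq addrAC eq_sym subr_eq.
by apply/eqP; rewrite h addrC.
Qed.

Let Zn (x : op M) (v : Hn) : Hn := fun i => commutator x (v i).

Let Zn_adjoint : adjoint_pair (Zn z) (Zn (adj z)).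
Proof.
move=> u v; rewrite !hpow_dotE.
by apply: eq_bigr => i _; exact: (commutator_adjoint Mz).
Qed.

Let Zn_grad u : Zn z (grad u) = grad (commutator z u).
Proof.
apply/funext => i; apply: commutatorC => //.
exact: z_center.2 (generator_mem i).
Qed.

Let grad_adj_Zn v : grad_adj v = 0 -> grad_adj (Zn z v) = 0.
Proof.
move=> v0; have -> : grad_adj (Zn z v) = commutator z (grad_adj v).
  rewrite /grad_adj (lin_sum (commutator_lin Mz)); apply: eq_bigr => i _.
  apply: commutatorC => //; apply/esym/z_center.2.
  exact: (star_adj As (generator_mem i)).
by rewrite v0 (lin0 (commutator_lin Mz)).
Qed.

Let grad_orth u v : grad_adj v = 0 -> '[grad u, v] = 0.
Proof. by move=> v0; rewrite grad_adjoint v0 linear0r. Qed.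

(* phi delta is a limit of gradients: the remainder w is orthogonal to gradients,
   and so is its image under z (x) 1 - 1 (x) z^o.  That image is also a limit of
   gradients, because phi delta is mapped to grad (delta z).  Hence it is 0. *)
Lemma derivation_landweber (delta : op M -> LW) c : derivation A delta -> 0 < c ->
  (forall u, rdot (grad u) (grad u) <= c * rdot u u) ->
  hcvg (fun k => grad (landweber grad grad_adj c (phi X delta : Hn) k))
    (phi X delta : Hn).
Proof.
move=> dd c0 gc.
have [w [w0]] := landweber_cvg grad_adjoint c0 gc (phi X delta : Hn).
set u := landweber _ _ _ _ => uw.
have y0 := grad_adj_Zn w0; set y := Zn z w in y0.
have h1 : '[(phi X delta : Hn), Zn (adj z) y] = 0.
  rewrite -Zn_adjoint (_ : Zn z (phi X delta) = grad (delta z)) ?grad_orth //.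
  by apply/funext => i; exact: derivation_center dd (generator_mem i).
have h2 : '[(phi X delta : Hn) - w, Zn (adj z) y] = 0.
  have := hcvg_dot_eq (v := Zn (adj z) y) (v' := 0) uw (hcvg_cst (0 : Hn)) _.
  by rewrite linear0l; apply => k; rewrite -Zn_adjoint Zn_grad grad_orth // ?linear0l.
have h3 : '[y, y] = 0.
  rewrite {1}/y Zn_adjoint; move: h2; rewrite linearBl /= h1 add0r => /eqP.
  by rewrite oppr_eq0 => /eqP.
have yE : y = 0 by apply/eqP; rewrite -(dnorm_eq0 (hdot Hn)) h3.
have wE : w = 0.
  apply/funext => i; apply: (diffuse_commutator_ker LM Mz z_diffuse).
  exact: (congr1 (fun v : Hn => v i) yE).
by move: uw; rewrite wE subr0.
Qed.

Lemma derivation_orth (delta : op M -> LW) (rho : Hn) : derivation A delta ->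
  grad_adj rho = 0 -> '[(phi X delta : Hn), rho] = 0.
Proof.
move=> dd rho0; have [c c0 gc] := grad_bounded.
have := hcvg_dot_eq (v := rho) (v' := 0) (derivation_landweber dd c0 gc)
  (hcvg_cst (0 : Hn)) _.
by rewrite linear0l; apply => k; rewrite grad_orth // ?linear0l.
Qed.

(** * The projection onto the closure of [Der11] and its trace *)

Section Projection.
Variable c : R.
Hypotheses (c0 : 0 < c) (gc : forall u, rdot (grad u) (grad u) <= c * rdot u u).

Local Notation e_ i := (unit_vector LW i : Hn).

Lemma grad_adj_unit i : grad_adj (e_ i) = commutator (adj (X i)) one.
Proof.
rewrite /grad_adj (bigD1 i) //= {1}/unit_vector eqxx big1 ?addr0 // => j /negPf ji.
by rewrite /unit_vector ji (lin0 (commutator_lin (MX' j))).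
Qed.

Lemma dot_unit (v : Hn) i : '[v, e_ i] = '[v i, one].
Proof.
rewrite hpow_dotE (bigD1 i) //= /unit_vector eqxx big1 ?addr0 // => j /negPf ji.
by rewrite ji linear0r.
Qed.

(** Each step applies commutators with generators and their adjoints, all in A, so the gradients of
    the iterates come from elements of [Der11]. *)
Lemma tensor_span_landweber i k : tensor_span A (landweber grad grad_adj c (e_ i) k).
Proof.
elim: k => [|k IHk] /=; first exact: tensor_span0.
apply: tensor_spanD => //; apply: (tensor_spanZ As AM).
apply: tensor_span_sum => j _.
apply: (tensor_span_commutator As AM); first exact: (star_adj As (generator_mem j)).
apply: (tensor_spanB As AM); last exact: (tensor_span_commutator As AM (generator_mem j)).
rewrite /unit_vector; case: eqP => _; [exact: tensor_span_one|exact: tensor_span0].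
Qed.

(** [orth_proj] chooses a vector by its property, so uniqueness is also required: the difference of
    two candidates lies in the span of K and is orthogonal to K. *)
Lemma orth_proj_unit i (w : Hn) : grad_adj w = 0 ->
  hcvg (fun k => grad (landweber grad grad_adj c (e_ i) k)) (e_ i - w) ->
  orth_proj (phi X @` [set d | closure_Der11 LM A X d]) (e_ i) = e_ i - w.
Proof.
move=> w0 iw; set K := _ @` _.
have Kw : K (e_ i - w).
  have [d dcl dw] := closure_Der11_limit (tensor_span_landweber i) iw.
  by exists d.
have Kw0 kappa : K kappa -> '[w, (kappa : Hn)] = 0.
  by move=> [d [dd _] <-]; rewrite hdotC (derivation_orth dd w0) rmorph0.
rewrite /orth_proj; case: xgetP => [eta _ [Keta etaP]|/(_ (e_ i - w)) []]; last first.
  split=> // kappa /Kw0 wk; rewrite -[RHS]wk [RHS]hpow_dotE.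
  apply: eq_bigr => j _; congr (hdot LW _ _).
  by rewrite -[(_ - w) j]/(e_ i j - w j) opprB addrC subrK.
have h kappa : K kappa -> '[(e_ i - w) - (eta : Hn), (kappa : Hn)] = 0.
  move=> Kk; have := etaP _ Kk; rewrite -(hpow_dotE (e_ i - (eta : Hn)) kappa) => e.
  by rewrite addrAC linearBl /= e Kw0 // subrr.
apply/esym/eqP; rewrite -subr_eq0 -(dnorm_eq0 (hdot Hn)) linearBr /=.
by rewrite !h // subrr.
Qed.

Let D i : op W := commutator_op (X i).
Let D' i : op W := commutator_op (adj (X i)).

Let WD i : vna_set W (D i). Proof. exact: vna_commutator. Qed.
Let WD' i : vna_set W (D' i). Proof. exact: vna_commutator. Qed.

(** The element L of W whose left action is [grad_adj] after [grad]. *)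
Definition laplacian : op W := fun u => \sum_(i < n) (D' i \o D i) u.

(** The partial Neumann sum of (1 - L/c)^j / c over j < k, written as a Landweber step; one
    polynomial in L serves all the unit vectors. *)
Fixpoint neumann k : op W :=
  if k is k'.+1
  then neumann k' \+ c^-1%:C \*: (idfun \- (laplacian \o neumann k'))
  else fun=> 0.

Lemma vna_laplacian : vna_set W laplacian.
Proof. by apply: (star_sum Ws) => i _; exact: (star_comp Ws (WD' i) (WD i)). Qed.

Let WL := vna_laplacian.

Lemma vna_neumann k : vna_set W (neumann k).
Proof.
elim: k => [|k IHk] /=; first exact: (star_zero Ws).
apply: (star_add Ws) => //; apply: (star_scale Ws); apply: (star_sub Ws).
  exact: (star_id Ws).
exact: (star_comp Ws).
Qed.

Let WN := vna_neumann.

Lemma grad_adj_grad_hat y : vna_set W y ->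
  grad_adj (grad (hat LW y)) = hat LW (laplacian \o y).
Proof.
move=> Wy; have WDy i := star_comp Ws (WD i) Wy.
rewrite /grad_adj; transitivity (\sum_(i < n) hat LW (D' i \o (D i \o y))).
  apply: eq_bigr => i _; rewrite /grad !commutatorE //.
  by rewrite (lmul_hat LW (WD i) Wy) (lmul_hat LW (WD' i) (WDy i)).
by rewrite -(hat_sum LW) => // i _; exact: (star_comp Ws (WD' i) (WDy i)).
Qed.

Lemma landweber_neumann i k :
  landweber grad grad_adj c (e_ i) k = hat LW (neumann k \o D' i).
Proof.
have WND j : vna_set W (neumann j \o D' i) := star_comp Ws (WN j) (WD' i).
elim: k => [|k IHk] /=; first by rewrite -(hat_zero LW).
rewrite (linB (adjoint_pair_linear (adjoint_pair_sym grad_adjoint))) IHk.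
have WLND := star_comp Ws WL (WND k); have WDi := star_comp Ws (WD' i) (star_id Ws).
have WB := star_sub Ws WDi WLND.
rewrite grad_adj_unit (grad_adj_grad_hat (WND k)) (commutatorE _ (MX' i)).
rewrite (lmul_hat LW (WD' i) (star_id Ws)) -(hat_sub LW WDi WLND).
by rewrite -(hat_scale LW _ WB) -(hat_add LW (WND k) (star_scale Ws _ WB)).
Qed.

Lemma residual_neumann k :
  one - hat LW (laplacian \o neumann k) = iter k (residual grad_adj grad c) one.
Proof.
elim: k => [|k IHk] /=.
  rewrite -grad_adj_grad_hat; last exact: (star_zero Ws).
  rewrite hat_zero (lin0 grad_lin).
  by rewrite (lin0 (adjoint_pair_linear (adjoint_pair_sym grad_adjoint))) subr0.
have WLN := star_comp Ws WL (WN k); have Wi := star_id Ws.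
have WiLN := star_sub Ws Wi WLN.
have WLB := star_comp Ws WL WiLN; have WcLB := star_scale Ws c^-1%:C WLB.
rewrite -IHk /residual -(hat_sub LW Wi WLN) (grad_adj_grad_hat WiLN).
rewrite -(hat_scale LW _ WLB) -(hat_sub LW WiLN WcLB).
rewrite -(hat_sub LW Wi (star_comp Ws WL (WN k.+1))).
congr hat; apply/funext => u /=.
have Ll := star_linear Ws WL.
by rewrite (linD Ll) (linZ Ll) opprD addrA.
Qed.

(** The i-th term is the trace of [D_i N_k D_i^*], hence of [N_k D_i^* D_i]. Summing over i gives
    the trace of [N_k L], and 1 - L N_k = (1 - L/c)^k. *)
Lemma trace_landweber k :
  \sum_(i < n) '[grad (landweber grad grad_adj c (e_ i) k), e_ i] =
  1 - '[iter k (residual grad_adj grad c) one, one].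
Proof.
have Wi := star_id Ws; have WLN := star_comp Ws WL (WN k).
have WND i : vna_set W (neumann k \o D' i) := star_comp Ws (WN k) (WD' i).
rewrite -residual_neumann linearBl /= !hat_dot_id // trace_id subKr.
rewrite (traceC WL (WN k)).
transitivity (\sum_(i < n) vna_trace W ((neumann k \o D' i) \o D i)).
  apply: eq_bigr => i _; rewrite dot_unit landweber_neumann /grad (commutatorE _ (MX i)).
  rewrite (lmul_hat LW (WD i) (WND i)) (hat_dot_id LW (star_comp Ws (WD i) (WND i))).
  exact: (traceC (WD i) (WND i)).
rewrite -trace_sum => [|i _]; last exact: (star_comp Ws (WND i) (WD i)).
congr vna_trace; apply/funext => u /=.
by rewrite /laplacian (lin_sum (star_linear Ws (WN k))).
Qed.

Lemma residual_one_cvg :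
  rdot (iter k (residual grad_adj grad c) one) one @[k --> \oo] --> (0 : R).
Proof.
have dg := adjoint_pair_sym grad_adjoint.
have [w ow w0] := residual_cvg dg c0 (adjoint_le grad_adjoint c0 gc) one.
by have := hcvg_rdot (v := one) ow; rewrite (grad_ker w0) /rdot linear0l.
Qed.

Lemma free_stein_dim1 : free_stein_dim LW LM A X = 1.
Proof.
have /choice[w wP] i := landweber_cvg grad_adjoint c0 gc (e_ i).
have -> : free_stein_dim LW LM A X = \sum_(i < n) '[e_ i - w i, e_ i].
  apply: eq_bigr => i _; rewrite hpow_dotE; apply: eq_bigr => j _.
  by congr (hdot LW _ _); have [w0 iw] := wP i; rewrite (orth_proj_unit w0 iw).
(* Since w i is orthogonal to the projection of [e_ i], each diagonal entry is a squared norm; the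
   dimension is thus real and can be computed as a limit in R. *)
have -> : \sum_(i < n) '[e_ i - w i, e_ i] =
    (\sum_(i < n) rdot (e_ i - w i) (e_ i))%:C.
  rewrite rmorph_sum; apply: eq_bigr => i _; have [w0 iw] := wP i.
  have pw : '[e_ i - w i, w i] = 0.
    have := hcvg_dot_eq (v := w i) (v' := 0) iw (hcvg_cst (0 : Hn)) _.
    by rewrite linear0l; apply => k; rewrite grad_orth // ?linear0l.
  have E : '[e_ i - w i, e_ i] = '[e_ i - w i, e_ i - w i].
    by rewrite [RHS]linearBr /= pw subr0.
  by rewrite {1}E dot_rdot /rdot -E.
congr (_%:C).
have l1 : \sum_(i < n) rdot (grad (landweber grad grad_adj c (e_ i) k)) (e_ i)
    @[k --> \oo] --> \sum_(i < n) rdot (e_ i - w i) (e_ i).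
  apply: cvg_big => [|i _]; first exact: add_continuous.
  by have [_ iw] := wP i; exact: hcvg_rdot iw.
suff l2 : \sum_(i < n) rdot (grad (landweber grad grad_adj c (e_ i) k)) (e_ i)
    @[k --> \oo] --> (1 : R).
  by apply: cvg_unique l1 l2; exact: norm_hausdorff.
rewrite -[X in _ --> X]subr0; have -> : (fun k =>
    \sum_(i < n) rdot (grad (landweber grad grad_adj c (e_ i) k)) (e_ i)) =
    (fun k => 1 - rdot (iter k (residual grad_adj grad c) one) one).
  apply/funext => k; have := congr1 (@complex.Re R) (trace_landweber k).
  by rewrite (big_morph (@complex.Re R) (@cReD R) (erefl : complex.Re 0 = 0)) cReD cReN.
by apply: cvgB; [exact: cvg_cst|exact: residual_one_cvg].
Qed.

End Projection.

End Generators.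

(* The trace on M (x) M^o and the L2-spaces exist and are unique up to unitary
   equivalence; sigma(A, tau) is computed from any of their models, and from any
   finite self-adjoint generating set X of A. *)
Theorem corollary3p3 (R : realType) (M : tracial_vna R)
    (W : tensor_vna M (opposite_vna M)) (LW : L2_space W) (LM : L2_space M)
    (A : set (op M))
    (A_star : star_subalgebra A) (A_sub : A `<=` vna_set M)
    (A_fg : finitely_generated A)
    (A_diffuse : exists z : op M, in_center A z /\ diffuse z)
    (n : nat) (X : 'I_n -> op M) (X_gen : selfadjoint_generators A X) :
  free_stein_dim LW LM A X = 1.
Proof.
have [z [zc zd]] := A_diffuse; have [c c0 gc] := grad_bounded LW A_sub X_gen.
exact: (free_stein_dim1 LM A_star A_sub X_gen zc zd c0 gc).
Qed.
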